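(* Let $p,q\in[1,\infty]$, $s\in\{0,1,2,\dots\}$, $\alpha\in\mathbb{R}$, let $Q_0$ be a cube of $\mathbb{R}^n$, and let $\mathcal{X}$ be either $\mathbb{R}^n$ or a cube of $\mathbb{R}^n$. Then: (i) for any $\widetilde p\in[p,\infty]$, $\widetilde{JN}_{(\widetilde p,q,s)_\alpha}(Q_0)\subset\widetilde{JN}_{(p,q,s)_\alpha}(Q_0)$ and, for every $f\in L^q_{\mathrm{loc}}(Q_0)$, $$|Q_0|^{-1/p}\|f\|_{\widetilde{JN}_{(p,q,s)_\alpha}(Q_0)}\le|Q_0|^{-1/\widetilde p}\|f\|_{\widetilde{JN}_{(\widetilde p,q,s)_\alpha}(Q_0)};$$ (ii) for any $\widetilde q\in[q,\infty]$, $\widetilde{JN}_{(p,\widetilde q,s)_\alpha}(\mathcal{X})\subset\widetilde{JN}_{(p,q,s)_\alpha}(\mathcal{X})$ and, for every $f\in L^{\widetilde q}_{\mathrm{loc}}(\mathcal{X})$, $$\|f\|_{\widetilde{JN}_{(p,q,s)_\alpha}(\mathcal{X})}\le\|f\|_{\widetilde{JN}_{(p,\widetilde q,s)_\alpha}(\mathcal{X})};$$ (iii) $\widetilde{JN}_{(p,q,s)_\alpha}(\mathcal{X})\subset\widetilde{JN}_{(p,q,s+1)_\alpha}(\mathcal{X})$ and, for every $f\in L^q_{\mathrm{loc}}(\mathcal{X})$, $$\|f\|_{\widetilde{JN}_{(p,q,s+1)_\alpha}(\mathcal{X})}\le\left\{[1+C_{(s+1)}][1+C_{(s)}]+C_{(s)}C_{(s+1)}\right\}\|f\|_{\widetilde{JN}_{(p,q,s)_\alpha}(\mathcal{X})},$$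 where, for each $t\in\{s,s+1\}$, $C_{(t)}\in[1,\infty)$ is a constant such that $|P^{(t)}_Q(f)(x)|\le C_{(t)}\frac1{|Q|}\int_Q|f|$ for every cube $Q$, every $f\in L^1(Q)$ and every $x\in Q$.
   Context: A cube in $\mathbb{R}^n$ has finite positive edge length and edges parallel to the coordinate axes; it need not be open or closed. Functions are real-valued. $\fint_Q f:=\frac1{|Q|}\int_Q f$. $L^q_{\mathrm{loc}}(\mathcal{X})$ is the set of measurable $f$ on $\mathcal{X}$ with $f\mathbf 1_E\in L^q(\mathcal{X})$ for every bounded $E\subset\mathcal{X}$. When $q=\infty$, $[\fint_Q|g|^q]^{1/q}$ means the essential supremum of $|g|$ on $Q$. $1/\infty:=0$. For $s\in\{0,1,2,\dots\}$, a cube $Q$ and $f$ integrable on $Q$, $P^{(s)}_Q(f)$ is the unique polynomial of degree at most $s$ such that $\int_Q[f(x)-P^{(s)}_Q(f)(x)]x^\gamma\,dx=0$ for every multi-index $\gamma$ with $|\gamma|\le s$. It is well known that constants $C_{(s)}$ as in the claim exist. For $f\in L^q_{\mathrm{loc}}(\mathcal{X})$ and $p\in[1,\infty)$, $$\|f\|_{\widetilde{JN}_{(p,q,s)_\alpha}(\mathcal{X})}:=\sup\left\{\sum_i|Q_i|\left[|Q_i|^{-\alpha}\left\{\fint_{Q_i}\left|f-P^{(s)}_{Q_i}(|f|)\right|^q\right\}^{1/q}\right]^p\right\}^{1/p},$$ the supremum being over all collections $\{Q_i\}_i$ of cubes contained in $\mathcal{X}$ with pairwise disjoint interiors; for $p=\infty$,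 $\|f\|_{\widetilde{JN}_{(\infty,q,s)_\alpha}(\mathcal{X})}:=\sup_{Q\subset\mathcal{X}}|Q|^{-\alpha}\{\fint_Q|f-P^{(s)}_Q(|f|)|^q\}^{1/q}$. $\widetilde{JN}_{(p,q,s)_\alpha}(\mathcal{X})$ is the set of $f\in L^q_{\mathrm{loc}}(\mathcal{X})$ for which this quantity is finite. *)

(* Defs.v *)
From HB Require Import structures.
From mathcomp Require Import all_boot all_order all_algebra.
From mathcomp Require Import all_classical all_reals all_analysis.
(* The notations of mpoly clash with those of MathComp-Analysis. *)
From mathcomp Require Import (coercions, canonicals) mpoly.

Set Implicit Arguments.
Unset Strict Implicit.
Unset Printing Implicit Defensive.

Import Order.TTheory GRing.Theory Num.Theory.
Import numFieldNormedType.Exports.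

Local Open Scope classical_set_scope.
Local Open Scope ring_scope.

Section lebesgue_step.
Context {R : realType} {n : nat}.
Local Notation RB := (measurableTypeR R).
Variable m : {sigma_finite_measure set (n.-tuple RB) -> \bar R}.

Definition cons_pair (z : RB * n.-tuple RB) : n.+1.-tuple RB :=
  [tuple of z.1 :: z.2].

Lemma measurable_cons_pair : measurable_fun [set: RB * n.-tuple RB] cons_pair.
Proof. exact: measurable_cons. Qed.

Definition lebesgue_step : set (n.+1.-tuple RB) -> \bar R :=
  pushforward (lebesgue_measure \x m)%E cons_pair.

Let lebesgue_step0 : lebesgue_step set0 = 0%E.
Proof. by rewrite /lebesgue_step /pushforward preimage_set0 measure0. Qed.

Let lebesgue_step_ge0 A : (0 <= lebesgue_step A)%E.
Proof. by apply: measure_ge0; exact: measurable_cons_pair. Qed.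

Let lebesgue_step_additive : semi_sigma_additive lebesgue_step.
Proof.
by apply: measure_semi_sigma_additive; exact: measurable_cons_pair.
Qed.

HB.instance Definition _ := isMeasure.Build _ _ _ lebesgue_step
  lebesgue_step0 lebesgue_step_ge0 lebesgue_step_additive.

Let lebesgue_step_sigma_finite : sigma_finite setT lebesgue_step.
Proof.
have /sigma_finiteP[F [FT ndF mF]] :=
  sigma_finiteT (@lebesgue_measure R : {sigma_finite_measure set _ -> \bar R}).
have /sigma_finiteP[G [GT ndG mG]] := sigma_finiteT m.
pose g (x : n.+1.-tuple RB) : RB * n.-tuple RB :=
  (tnth x ord0, [tuple of behead x]).
have mg : measurable_fun setT g.
  apply/measurable_fun_pairP; split; first exact: measurable_tnth.
  exact: measurable_behead.
have gK : cancel cons_pair g.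
  by move=> [a t]; rewrite /g /cons_pair /=; congr pair; exact: val_inj.
exists (fun k => g @^-1` (F k `*` G k)).
  rewrite -preimage_bigcup; apply/esym; rewrite -subTset => x _.
  have : [set: RB] (g x).1 by [].
  have : [set: n.-tuple RB] (g x).2 by [].
  rewrite FT GT => -[j _ Gj] [i _ Fi]; exists (maxn i j) => //; split.
    by move: Fi; exact/subsetPset/ndF/leq_maxl.
  by move: Gj; exact/subsetPset/ndG/leq_maxr.
move=> k; have [mFk Fk] := mF k; have [mGk Gk] := mG k.
have mFG : measurable (F k `*` G k) by exact: measurableX.
split; first by rewrite -[X in measurable X]setTI; exact: mg.
rewrite /lebesgue_step /pushforward -comp_preimage.
have -> : g \o cons_pair = id by apply/funext => z /=; rewrite gK.
by rewrite preimage_id product_measure1E// lte_mul_pinfty// ge0_fin_numE.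
Qed.

HB.instance Definition _ := Measure_isSigmaFinite.Build _ _ _ lebesgue_step
  lebesgue_step_sigma_finite.

End lebesgue_step.

(* n-fold product of the one-dimensional Lebesgue measure, on the product of
   the Borel sigma-algebras *)
Fixpoint lebesgue_borel (R : realType) (n : nat) :
    {sigma_finite_measure set (n.-tuple (measurableTypeR R)) -> \bar R} :=
  if n is k.+1
  then lebesgue_step (lebesgue_borel R k) : {sigma_finite_measure set _ -> \bar R}
  else \d_ [tuple].

(* R^n with the sigma-algebra of Lebesgue measurable sets, i.e. of the
   Caratheodory measurable sets for the outer measure induced by
   [lebesgue_borel R n] *)
Definition Rn (R : realType) (n : nat) :=
  caratheodory_type ((lebesgue_borel R n)^*)%mu.
HB.instance Definition _ R n := Measurable.on (Rn R n).

Definition lebesgue (R : realType) (n : nat) :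
    {measure set (Rn R n) -> \bar R} :=
  @completed_measure_extension _ _ _ (lebesgue_borel R n).

Section JN.
Context {R : realType} {n : nat}.
Implicit Types (x y : Rn R n) (A E Q X : set (Rn R n)) (f g : Rn R n -> R).
Implicit Types (p q : \bar R) (s t : nat) (alpha : R).

Local Notation mu := (lebesgue R n).

Definition coordn x (i : 'I_n) : R := tnth (x : n.-tuple R) i.

(* Each of the 2n faces may or may not belong to the cube: [BSide true] is a
   closed lower or an open upper endpoint, [BSide false] the opposite. *)
Definition cube Q := exists (a : 'I_n -> R) (l : R) (bl br : 'I_n -> bool),
  0 < l /\
  Q = [set x | forall i,
         coordn x i \in Interval (BSide (bl i) (a i)) (BSide (br i) (a i + l))].

Definition interiorn A : set (Rn R n) :=
  [set x | exists2 e : R, 0 < e &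
    forall y, (forall i, `|coordn y i - coordn x i| < e) -> A y].

Definition boundedn E :=
  exists M : R, forall x, E x -> forall i, `|coordn x i| <= M.

Definition vol Q : R := fine (mu Q).

Definition Lloc q X : set (Rn R n -> R) :=
  [set f : Rn R n -> R | measurable_fun X f /\
    forall E, measurable E -> boundedn E -> E `<=` X ->
      ('N[mu]_q[(fun x => (f x * \1_E x)%:E)] < +oo)%E].

(* the q-average over Q, for 1 <= q; -oo is a dummy case *)
Definition avg q Q g : \bar R :=
  match q with
  | r%:E => (((vol Q)^-1)%:E * \int[mu]_(x in Q) (`|g x| `^ r)%:E) `^ r^-1
  | +oo => ereal_inf [set y | {ae mu, forall x, Q x -> (`|g x|%:E <= y)%E}]
  | -oo => 0
  end%E.

Definition monom (gamma : mpoly.multinom n) x : R :=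
  \prod_(i < n) coordn x i ^+ gamma i.

Definition peval (P : mpoly.mpoly n R) x : R := mpoly.meval (coordn x) P.

(* degree at most s: [msize] is one more than the degree *)
Definition is_polyproj s Q f (P : mpoly.mpoly n R) :=
  (mpoly.msize P <= s.+1)%N /\
  forall gamma : mpoly.multinom n, (mpoly.mdeg gamma <= s)%N ->
    \int[mu]_(x in Q) ((f x - peval P x) * monom gamma x) = 0.

(* the unique P such that [is_polyproj s Q f P], when f is integrable on Q *)
Definition polyproj s Q f : mpoly.mpoly n R := xget 0 (is_polyproj s Q f).

Definition osc q s alpha f Q : \bar R :=
  ((vol Q `^ (- alpha))%:E
    * avg q Q (fun x => f x - peval (polyproj s Q (fun z => `|f z|)) x)%R)%E.

(* Since cubes have nonempty interiors, an indexed family of cubes with pairwise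
   disjoint interiors has no repetition: it amounts to a set of cubes. *)
Definition packing X (C : set (set (Rn R n))) :=
  (forall Q, C Q -> cube Q /\ Q `<=` X) /\
  (forall Q Q', C Q -> C Q' -> Q <> Q' -> interiorn Q `&` interiorn Q' = set0).

(* the norm, for 1 <= p; -oo is a dummy case *)
Definition JNnorm p q s alpha X f : \bar R :=
  match p with
  | r%:E =>
      ereal_sup [set \esum_(Q in C) ((vol Q)%:E * (osc q s alpha f Q) `^ r)
                | C in packing X] `^ r^-1
  | +oo => ereal_sup [set osc q s alpha f Q | Q in [set Q | cube Q /\ Q `<=` X]]
  | -oo => 0
  end%E.

Definition JN p q s alpha X : set (Rn R n -> R) :=
  [set f : Rn R n -> R | Lloc q X f /\ (JNnorm p q s alpha X f < +oo)%E].

Definition polyproj_bound t (C : R) :=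
  1 <= C /\
  forall Q f, cube Q -> mu.-integrable Q (EFin \o f) ->
    forall x, Q x ->
      `|peval (polyproj t Q f) x| <= C * ((vol Q)^-1 * \int[mu]_(x in Q) `|f x|).

End JN.
Arguments polyproj_bound {R} n t C.

(* Main.v *)
Require Import Defs.
From HB Require Import structures.
From mathcomp Require Import all_boot all_order all_algebra.
From mathcomp Require Import all_classical all_reals all_analysis.
From mathcomp Require Import (coercions, canonicals) mpoly.
From mathcomp Require Import measurable_realfun ess_sup_inf qpoly ring lra zify.
Import Order.TTheory GRing.Theory Num.Theory.
Import numFieldNormedType.Exports.
Local Open Scope classical_set_scope.
Local Open Scope ring_scope.

Set Implicit Arguments.
Unset Strict Implicit.

(* Parts (i) and (ii) are Jensen's inequality, for the weights [vol Q_i] of a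
   packing of [Q0] (whose sum is at most [vol Q0]) and for averages over a cube.
   Both reduce to the tangent line inequality of the concave function
   [t `^ theta], scaled by a free parameter and integrated.

   For (iii), let [P] and [P1] be the projections of [|f|] of degrees [s] and
   [s + 1]. Then [P1 - P] is the projection of degree [s + 1] of [|f| - P], so it
   is bounded by [C_(s+1)] times the average of [||f| - P|]; since [|f| - P] has
   mean zero, this average is at most twice that of [|f - P|]. Hence the factor
   [1 + 2 C_(s+1)], which is smaller than the one claimed.

   The existence of the projections and of the constants [C_(s)] rests on the
   bound of the supremum of a polynomial over a cube by its average, uniformly in
   the cube: in one variable by Lagrange interpolation at suitable points of
   equally spaced subintervals, in [n] variables by Tonelli. *)

(** * Suprema and integrals of polynomials in one variable *)

(** In Lagrange's formula each factor [(x - y_j) / (y_i - y_j)] has a numerator of size at most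
    [(2 * d + 1) * h] and a denominator of size at least [h]. *)
Lemma lagrange_bound (R : realFieldType) (p : {poly R}) (d : nat)
    (a h m x : R) (y : nat -> R) :
  0 < h -> (size p <= d)%N ->
  (forall i, a + h * (2 * i + 1)%:R <= y i <= a + h * (2 * i + 2)%:R) ->
  (forall i, (i < d)%N -> `|p.[y i]| <= m) ->
  a <= x <= a + h * (2 * d + 1)%:R ->
  `|p.[x]| <= (d * (2 * d + 1) ^ d)%:R * m.
Proof.
move=> h0 szp yi pm /andP[ax xb].
have [d0|d0] := posnP d.
  by move: szp; rewrite d0 leqn0 size_poly_eq0 => /eqP ->; rewrite horner0 normr0 mul0r.
(* A gap of length [h] separates the subintervals of consecutive nodes. *)
have yh i j : (i < j)%N -> h <= y j - y i.
  move=> ij; have /andP[_ yi2] := yi i; have /andP[yj1 _] := yi j.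
  rewrite lerBrDl (le_trans _ yj1)//.
  apply: (le_trans (lerD yi2 (lexx h))).
  rewrite -addrA lerD2l -[X in _ + X]mulr1 -mulrDr ler_wpM2l// ?(ltW h0)//.
  by rewrite -(natrD _ _ 1) ler_nat; lia.
have yh' i j : i != j -> h <= `|y j - y i|.
  case: (ltngtP i j) => // ij _; first exact: le_trans (yh _ _ ij) (ler_norm _).
  by rewrite distrC; exact: le_trans (yh _ _ ij) (ler_norm _).
have yinj : injective y.
  move=> i j yij; apply/eqP; apply: contraT => /yh'.
  by rewrite yij subrr normr0 leNgt h0.
rewrite (lagrange_gen d0 yinj szp) horner_sum.
apply: (le_trans (ler_norm_sum _ _ _)).
rewrite natrM -mulrA mulr_natl -[X in _ *+ X](card_ord d) -sumr_const.
apply: ler_sum => i _.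
rewrite lagrangeE// hornerM hornerC mulrC normrM ler_pM//; last exact: pm.
rewrite hornerM hornerC !horner_prod -prodfV -big_split/= normr_prod.
have N1 : 1 <= (2 * d + 1)%:R :> R by rewrite ler1n; lia.
(* The absent factor [j = i] counts as [1], which is at most [2 * d + 1]; hence the exponent [d]. *)
rewrite natrX -[X in _ ^+ X]card_ord -prodr_const [leLHS]big_mkcond /=.
apply: ler_prod => j _; case: ifPn => [ji|_]; last by rewrite ler01.
rewrite normr_ge0/= !hornerXsubC normrM normfV mulrC.
have yij : h <= `|y i - y j| by apply: yh'.
rewrite ler_pdivrMr ?(lt_le_trans h0)//.
apply: (@le_trans _ _ ((2 * d + 1)%:R * h)); last by rewrite ler_wpM2l.
have /andP[yj1 yj2] := yi j.
have : h * (2 * j + 1)%:R >= 0 by rewrite mulr_ge0// ltW.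
have : h * (2 * j + 2)%:R <= h * (2 * d + 1)%:R.
  by rewrite ler_wpM2l ?ler_nat ?(ltW h0)//; have := ltn_ord j; lia.
rewrite [_ %:R * h]mulrC ler_norml; lra.
Qed.

(** The interval is cut into [2 * d + 1] parts of length [h]. On every second one [|p|] is somewhere
    at most its whole integral divided by [h], up to a slack; these points are the nodes of
    [lagrange_bound]. *)
Lemma poly_le_itv_integral (R : realType) (p : {poly R}) (d : nat) (a l x : R)
    (bl br : bool) :
  0 < l -> (size p <= d)%N ->
  x \in Interval (BSide bl a) (BSide br (a + l)) ->
  ((`|p.[x]| * l)%:E <= (d * (2 * d + 1) ^ d.+1)%:R%:E *
    \int[lebesgue_measure]_(y in [set` Interval (BSide bl a) (BSide br (a + l)%R)])
      `|p.[y]|%:E)%E.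
Proof.
have gaps i : (i < d)%N -> (2 * i + 2 < 2 * d + 1)%N by lia.
move=> l0 szp xI; set I := Interval _ _.
have D0 : 0 < (2 * d + 1)%:R :> R by rewrite ltr0n addn1.
pose h := l / (2 * d + 1)%:R.
have h0 : 0 < h by rewrite divr_gt0.
have lE : l = h * (2 * d + 1)%:R by rewrite divfK// gt_eqF.
have mp (D : set R) : measurable D -> measurable_fun D ((fun y => (`|p.[y]|)%:E) : R -> \bar R).
  move=> mD; apply/measurable_EFinP; apply: measurableT_comp => //.
  by apply: subspace_continuous_measurable_fun => //;
    apply: continuous_subspaceT => z; exact: continuous_horner.
have [d0|d0] := posnP d.
  move: szp; rewrite d0 leqn0 size_poly_eq0 => /eqP ->.
  by rewrite horner0 normr0 mul0r mul0n mul0e.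
have K0 : 0 < (d * (2 * d + 1) ^ d.+1)%:R :> R.
  by rewrite ltr0n muln_gt0 d0 expn_gt0 addn1.
have I0 : (0 <= \int[lebesgue_measure]_(y in [set` I]) `|p.[y]|%:E)%E.
  by apply: integral_ge0 => y _; rewrite lee_fin.
set J := (X in (_ * X)%E).
case: (ltP J +oo%E) => [Jy|]; last first.
  by rewrite leye_eq => /eqP ->; rewrite gt0_muley// leey.
have Jfin : J \is a fin_num by rewrite ge0_fin_numE.
rewrite -(fineK Jfin) -EFinM lee_fin; set c := fine J.
(* The slack [e'] makes the contradiction below strict; times the final constant it is [e]. *)
apply/ler_addgt0Pr => e e0; pose e' := e / (d * (2 * d + 1) ^ d.+1)%:R.
have e'0 : 0 < e' by rewrite divr_gt0.
pose I_ i := [set` `[a + h * (2 * i + 1)%:R, a + h * (2 * i + 2)%:R]] : set R.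
have /choice[y Hy] i : exists z, I_ i z /\
    ((i < d)%N -> `|p.[z]| <= (c + e') / h).
  have le12 : a + h * (2 * i + 1)%:R <= a + h * (2 * i + 2)%:R.
    by rewrite lerD2l ler_wpM2l ?(ltW h0)// ler_nat leq_add2l.
  have [id|di] := ltnP i d; last first.
    by exists (a + h * (2 * i + 1)%:R); split => //; rewrite /I_ /= in_itv/= lexx.
  (* Otherwise [|p|] is at least [(c + e') / h] on a subinterval of length [h], so its integral
     exceeds [c]. *)
  apply: contrapT => /forallNP H.
  have pge z : I_ i z -> (c + e') / h <= `|p.[z]|.
    move=> Iz; have := H z; rewrite not_andP => -[//|/not_implyP[_ /negP]].
    by rewrite -ltNge => /ltW.
  have ce0 : (0 <= ((c + e') / h)%:E)%E.
    by rewrite lee_fin divr_ge0 ?(ltW h0)// addr_ge0 ?(ltW e'0)// fine_ge0.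
  have pge' z : I_ i z -> (((c + e') / h)%:E <= `|p.[z]|%:E)%E.
    by move=> /pge; rewrite lee_fin.
  have mpI : measurable_fun (I_ i) ((fun y => `|p.[y]|%:E) : R -> \bar R).
    by apply: mp; exact: measurable_itv.
  have mI : measurable (I_ i : set (measurableTypeR R)).
    exact: measurable_itv.
  have : (\int[lebesgue_measure]_(z in I_ i) ((c + e') / h)%:E <= J)%E.
    apply: (@le_trans _ _ (\int[lebesgue_measure]_(z in I_ i) `|p.[z]|%:E)%E).
      by apply: ge0_le_integral => //=.
    apply: ge0_subset_integral => //=; first by apply: mp; exact: measurable_itv.
    (* The chosen subintervals lie between [a + h] and [a + l - h], hence inside [I] whatever its
       endpoints. *)
    have h1 : 0 < h * (2 * i + 1)%:R by rewrite mulr_gt0// ltr0n addn1.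
    have h2 : h * (2 * i + 2)%:R < l by rewrite lE ltr_pM2l// ltr_nat gaps.
    move=> z; rewrite /I_ /I /= in_itv/= => /andP[z1 z2].
    by rewrite itv_boundlr; apply/andP; split; [case: (bl)|case: (br)]; rewrite bnd_simp; lra.
  rewrite integral_cst//= lebesgue_measure_itv/= lte_fin.
  have -> : a + h * (2 * i + 1)%:R < a + h * (2 * i + 2)%:R.
    by rewrite ltrD2l ltr_pM2l// ltr_nat ltn_add2l.
  rewrite -EFinB -EFinM -(fineK Jfin) lee_fin -/c.
  have -> : a + h * (2 * i + 2)%:R - (a + h * (2 * i + 1)%:R) = h.
    have -> : (2 * i + 2)%:R = (2 * i + 1)%:R + 1 :> R.
      by rewrite natr1 -addnS.
    ring.
  by rewrite divfK ?gt_eqF// leNgt ltrDl e'0.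
have xal : a <= x <= a + h * (2 * d + 1)%:R.
  rewrite -lE; move: xI; rewrite itv_boundlr => /andP[x1 x2].
  apply/andP; split.
    by move: x1; case: (bl); rewrite bnd_simp => // /ltW.
  by move: x2; case: (br); rewrite bnd_simp => // /ltW.
have := @lagrange_bound R p d a h ((c + e') / h) x y h0 szp _ _ xal.
move=> /(_ _)/(_ _)/le_trans-/(_ _)/(_ _)/(_ _) => Hb.
have {}Hb : `|p.[x]| <= (d * (2 * d + 1) ^ d)%:R * ((c + e') / h).
  apply: Hb (lexx _) => [i|i id].
    by have [] := Hy i; rewrite /I_/= in_itv.
  by have [_] := Hy i; exact.
apply: (le_trans (ler_wpM2r (ltW l0) Hb)).
rewrite lE.
have -> : (d * (2 * d + 1) ^ d)%:R * ((c + e') / h) * (h * (2 * d + 1)%:R)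
  = (d * (2 * d + 1) ^ d.+1)%:R * (c + e') :> R.
  by rewrite expnSr mulnA natrM; field; rewrite gt_eqF.
by rewrite mulrDr /e' [X in _ + X]mulrCA divff ?gt_eqF// mulr1.
Qed.

(** * Change of variables, boxes and Tonelli for the Borel product measure *)

(** Applied to [cons_pair], to split off one coordinate, and to the identity from Lebesgue to Borel
    measurable sets. *)
Lemma ge0_integral_image d1 d2 (T1 : measurableType d1) (T2 : measurableType d2)
    (R : realType) (m1 : {measure set T1 -> \bar R})
    (m2 : {measure set T2 -> \bar R}) (phi : T1 -> T2) (D : set T2)
    (f : T2 -> \bar R) :
  measurable_fun setT phi ->
  (forall A, measurable A -> m2 A = m1 (phi @^-1` A)) ->
  measurable D -> measurable_fun D f -> (forall x, 0 <= f x)%E ->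
  (\int[m2]_(x in D) f x = \int[m1]_(x in phi @^-1` D) f (phi x))%E.
Proof.
move=> mphi m12 mD mf f0.
rewrite -(ge0_integral_pushforward mphi m1 mD mf); last by move=> x _; exact: f0.
by apply: eq_measure_integral => A mA _; exact: m12.
Qed.

Section borel_boxes.
Context {R : realType}.
Local Notation RB := (measurableTypeR R).

(** The sets that define [cube], seen in the product of the Borel sigma-algebras, where Tonelli
    applies. *)
Definition box {n} (a : 'I_n -> R) (l : R) (bl br : 'I_n -> bool) :
    set (n.-tuple RB) :=
  [set x | forall i, tnth x i \in
    Interval (BSide (bl i) (a i)) (BSide (br i) (a i + l))].

Lemma cons_pair_box n (a : 'I_n.+1 -> R) l bl br :
  cons_pair @^-1` box a l bl br =
  [set` Interval (BSide (bl ord0) (a ord0)) (BSide (br ord0) (a ord0 + l))] `*`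
  box (a \o lift ord0) l (bl \o lift ord0) (br \o lift ord0).
Proof.
apply/seteqP; split=> -[t x] /=; rewrite /box /cons_pair /=.
  move=> tx; split; first by have := tx ord0; rewrite tnth0.
  by move=> i; have := tx (lift ord0 i); rewrite tnthS.
by move=> [t0 xi] i; case: (unliftP ord0 i) => [j ->|->]; rewrite ?tnthS ?tnth0//.
Qed.

Lemma measurable_box n (a : 'I_n -> R) l bl br : measurable (box a l bl br).
Proof.
rewrite (_ : box _ _ _ _ = \bigcap_(i in [set: 'I_n])
    ((fun x : n.-tuple RB => tnth x i) @^-1`
    [set` Interval (BSide (bl i) (a i)) (BSide (br i) (a i + l))])); last first.
  by apply/seteqP; split => [x bx i _|x bx i]; exact: bx.
apply: fin_bigcap_measurable => // i _.
rewrite -[X in measurable X]setTI; exact: measurable_tnth.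
Qed.

Lemma lebesgue_borel_box n (a : 'I_n -> R) l bl br : 0 < l ->
  lebesgue_borel R n (box a l bl br) = (l ^+ n)%:E.
Proof.
move=> l0; elim: n a bl br => [|n IH] a bl br /=.
  by rewrite diracE mem_set// => -[].
rewrite /lebesgue_step /pushforward cons_pair_box product_measure1E//=.
rewrite IH lebesgue_measure_itv/= lte_fin ltrDl l0 -EFinB -EFinM exprS.
by rewrite addrAC subrr add0r.
exact: measurable_box.
Qed.

(** The domain moves into the integrand, so that both iterated integrals run over whole spaces
    although [D] need not be a product. *)
Lemma integral_lebesgue_borel_cons n (D : set (n.+1.-tuple RB))
    (f : n.+1.-tuple RB -> \bar R) :
  measurable D -> measurable_fun [set: n.+1.-tuple RB] f ->
  (forall x, 0 <= f x)%E ->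
  (\int[lebesgue_borel R n.+1]_(x in D) f x =
   \int[lebesgue_measure]_t \int[lebesgue_borel R n]_y
     ((f \_ D) (cons_pair (t, y))))%E.
Proof.
move=> mD mf f0; rewrite integral_mkcond.
have mfD : measurable_fun setT (f \_ D).
  by apply/(measurable_restrictT f mD); exact: measurable_funTS.
have fD0 x : (0 <= (f \_ D) x)%E by rewrite patchE; case: ifP.
rewrite (ge0_integral_image (m1 := (lebesgue_measure \x lebesgue_borel R n)%E)
  (@measurable_cons_pair R n) _ measurableT)//.
apply: (@fubini_tonelli1 _ _ _ _ R lebesgue_measure (lebesgue_borel R n)) => //.
  exact: measurableT_comp mfD (@measurable_cons_pair R n).
Qed.

End borel_boxes.

(** * The supremum bound for polynomials in several variables *)

Section monomial_sums.
Context {R : realType} {J : finType}.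
Local Notation RB := (measurableTypeR R).

(** An arbitrary finite index type suits both uses: fixing the first variable only changes the
    coefficients, and a square is again such a sum, over pairs of indices. *)
Definition monsum {n} (c : J -> R) (g : J -> 'I_n -> nat) (x : n.-tuple RB) : R :=
  \sum_j c j * \prod_(i < n) (tnth x i : R) ^+ g j i.

Lemma measurable_monsum n c (g : J -> 'I_n -> nat) :
  measurable_fun setT (monsum c g).
Proof.
apply: measurable_sum => j; apply: measurable_funM => //.
apply: measurable_prod => i _; apply: measurable_funX.
exact: measurable_tnth.
Qed.

Lemma monsum_cons n c (g : J -> 'I_n.+1 -> nat) t (y : n.-tuple RB) :
  monsum c g (cons_pair (t, y)) =
  monsum (fun j => c j * (t : R) ^+ g j ord0) (fun j => g j \o lift ord0) y.
Proof.
apply: eq_bigr => j _; rewrite big_ord_recl -mulrA /cons_pair/= tnth0.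
by congr (_ * (_ * _)); apply: eq_bigr => i _; rewrite tnthS.
Qed.

Lemma monsum_cons_poly n c (g : J -> 'I_n.+1 -> nat) d (y : n.-tuple RB) :
  (forall j, g j ord0 < d)%N ->
  exists2 p : {poly R}, (size p <= d)%N &
    forall t, monsum c g (cons_pair (t, y)) = p.[t].
Proof.
move=> gd; exists (\sum_j (c j * \prod_(i < n) (tnth y i : R) ^+ g j (lift ord0 i))
    *: 'X^(g j ord0)).
  apply: (leq_trans (size_sum _ _ _)); apply/bigmax_leqP => j _.
  by apply: (leq_trans (size_scale_leq _ _)); rewrite size_polyXn.
move=> t; rewrite monsum_cons horner_sum; apply: eq_bigr => j _.
by rewrite hornerZ hornerXn mulrAC.
Qed.

(** Induction on the dimension. With the other coordinates frozen at those of [x], the one-variable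
    bound gives an integral over the first coordinate [t]; for each [t] the induction hypothesis
    bounds the integrand by an integral over the other coordinates. *)
Lemma monsum_le_integral_borel n c (g : J -> 'I_n -> nat) d a l bl br x :
  0 < l -> (forall j i, g j i < d)%N -> box a l bl br x ->
  ((`|monsum c g x| * l ^+ n)%:E <=
    ((d * (2 * d + 1) ^ d.+1) ^ n)%:R%:E *
    \int[lebesgue_borel R n]_(y in box a l bl br) `|monsum c g y|%:E)%E.
Proof.
move=> l0; set K := (d * _)%N; elim: n => [|n IH] in c g a bl br x *.
  move=> _ _; rewrite expn0 mul1e expr0 mulr1.
  have -> : box a l bl br = setT by apply/seteqP; split => // y _ [].
  rewrite integral_dirac//=; last first.
    by apply/measurable_EFinP; apply: measurableT_comp => //;
      exact: measurable_monsum.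
  by rewrite diracT mul1e (tuple0 x).
move=> gd bx.
pose t0 : R := tnth x ord0; pose x' : n.-tuple RB := [tuple of behead x].
have xE : x = cons_pair (t0, x').
  by rewrite /cons_pair /t0 /x'; apply: val_inj; rewrite /= [in LHS](tuple_eta x).
have : (cons_pair @^-1` box a l bl br) (t0, x') by rewrite /preimage/= -xE.
rewrite cons_pair_box => -[/= tI bx'].
set I := Interval _ _ in tI; set B := box _ _ _ _ in bx'.
have mF D : measurable_fun D ((fun y => `|monsum c g y|%:E) : n.+1.-tuple RB -> \bar R).
  apply: measurable_funTS; apply/measurable_EFinP; apply: measurableT_comp => //.
  exact: measurable_monsum.
have mB : measurable (box a l bl br) by exact: measurable_box.
rewrite integral_lebesgue_borel_cons//.
have [p szp pE] := @monsum_cons_poly n c g d x' (fun j => gd j ord0).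
rewrite {1}xE pE exprSr mulrA mulrAC.
have ln0 : 0 <= l ^+ n by rewrite exprn_ge0// ltW.
rewrite EFinM muleC.
have pI := @poly_le_itv_integral R p d (a ord0) l t0 (bl ord0) (br ord0) l0 szp tI.
apply: (le_trans (lee_wpmul2l _ pI)) => //.
rewrite -/K [(K ^ n.+1)%N]expnS (natrM _ K) EFinM -(muleA K%:R%:E).
rewrite [leLHS]muleCA; apply: lee_wpmul2l => //.
have mp (D : set R) : measurable D -> measurable_fun D ((fun y => `|p.[y]|%:E) : R -> \bar R).
  move=> mD; apply/measurable_EFinP; apply: measurableT_comp => //.
  by apply: subspace_continuous_measurable_fun => //;
    apply: continuous_subspaceT => z; exact: continuous_horner.
have mf : measurable_fun setT
    (((fun y => `|monsum c g y|%:E) \_ (box a l bl br)) \o @cons_pair R n).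
  apply: measurableT_comp; last exact: measurable_cons_pair.
  by apply/(measurable_restrictT _ mB); exact: mF.
have f0 z : (0 <= (((fun y => `|monsum c g y|%:E) \_ (box a l bl br)) \o @cons_pair R n) z)%E.
  by rewrite /= patchE; case: ifP => // _; rewrite lee_fin.
have mFF := @measurable_fun_fubini_tonelli_F _ _ (measurableTypeR R) _ R
  (lebesgue_borel R n) _ mf f0.
rewrite -ge0_integralZl_EFin//; last exact: (mp _ (measurable_itv _)).
rewrite -ge0_integralZl_EFin//; last first.
  by first [exact: mFF|move=> t _; apply: integral_ge0 => y _; exact: (f0 (t, y))].
(* The left integral is over the side [I], the right one over the line; the left integrand is
   extended by zero. *)
rewrite [leLHS]integral_mkcond.
apply: ge0_le_integral => //.
- by move=> t _; rewrite patchE; case: ifP => // _; rewrite lee_fin mulr_ge0.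
- apply/(measurable_restrictT _ (measurable_itv _)).
  by apply: measurable_funeM; exact: (mp _ (measurable_itv _)).
- apply: measurable_funeM.
  exact: mFF.
move=> t _; rewrite patchE; case: ifPn => [|_]; last first.
  by rewrite mule_ge0// integral_ge0// => y _; exact: (f0 (t, y)).
rewrite inE/= => tI'.
rewrite -pE monsum_cons -EFinM mulrC.
apply: (le_trans (IH _ _ _ _ _ _ (fun j i => gd j (lift ord0 i)) bx')).
apply: lee_wpmul2l => //; rewrite integral_mkcond le_eqVlt; apply/orP; left.
apply/eqP; apply: eq_integral => y _; rewrite !patchE monsum_cons.
(* For [t] in [I], the slice of the box at [t] is [B]. *)
suff -> : (y \in B) = (cons_pair (t, y) \in box a l bl br) by [].
apply/idP/idP; rewrite !inE => By.
  by have : (cons_pair @^-1` box a l bl br) (t, y) by rewrite cons_pair_box.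
have : (cons_pair @^-1` box a l bl br) (t, y) by [].
by rewrite cons_pair_box => -[].
Qed.

End monomial_sums.

(** * Cubes as Lebesgue measurable sets *)

Section cubes.
Context {R : realType} {n : nat}.
Local Notation RB := (measurableTypeR R).
Local Notation mu := (lebesgue R n).

Lemma measurable_id_Rn :
  measurable_fun [set: Rn R n] (id : Rn R n -> n.-tuple RB).
Proof.
move=> _ A mA; rewrite setTI preimage_id.
by apply: sub_caratheodory; exact: sub_sigma_algebra.
Qed.

Lemma measurable_borel_Rn (A : set (n.-tuple RB)) :
  measurable A -> measurable (A : set (Rn R n)).
Proof.
move=> mA; rewrite -[X in measurable X]setTI.
exact: measurable_id_Rn.
Qed.

Lemma lebesgue_borelE (A : set (n.-tuple RB)) :
  measurable A -> mu A = lebesgue_borel R n A.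
Proof. by move=> mA; exact: measurable_mu_extE. Qed.

Lemma ge0_integral_borel (D : set (n.-tuple RB)) (f : n.-tuple RB -> \bar R) :
  measurable D -> measurable_fun D f -> (forall x, 0 <= f x)%E ->
  (\int[mu]_(x in D) f x = \int[lebesgue_borel R n]_(x in D) f x)%E.
Proof.
move=> mD mf f0; symmetry.
apply: (ge0_integral_image measurable_id_Rn _ mD mf f0) => A mA.
by symmetry; exact: lebesgue_borelE.
Qed.

(** The set [O] is a measurable stand-in for the interior: it inherits disjointness and loses no
    volume. *)
Definition cube_facts (Q : set (Rn R n)) :=
  [/\ measurable Q, mu Q = (vol Q)%:E, 0 < vol Q &
    exists O : set (Rn R n), [/\ measurable O, O `<=` interiorn Q,
      O `<=` Q & mu O = mu Q]].

Lemma cubeP (Q : set (Rn R n)) : cube Q -> cube_facts Q.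
Proof.
move=> [a [l [bl [br [l0 ->]]]]].
have mub bl' br' : mu (box a l bl' br') = (l ^+ n)%:E.
  by rewrite lebesgue_borelE ?lebesgue_borel_box//; exact: measurable_box.
have mb bl' br' : measurable (box a l bl' br' : set (Rn R n)).
  by apply: measurable_borel_Rn; exact: measurable_box.
rewrite -/(box a l bl br).
split; [exact: mb| |by rewrite /vol mub/= exprn_gt0|].
  by rewrite /vol mub.
(* The open cube with the same sides, since [BSide false] on the left and [BSide true] on the right
   are open endpoints. *)
exists (box a l (fun=> false) (fun=> true)).
have sub : box a l (fun=> false) (fun=> true) `<=` box a l bl br.
  move=> x + i => /(_ i); rewrite !itv_boundlr => /andP[].
  by rewrite !bnd_simp; case: (bl i); case: (br i); rewrite !bnd_simp => ? ?;
    apply/andP; split => //; exact: ltW.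
split; [exact: mb| |exact: sub|by rewrite !mub].
move=> x xO.
(* The distance from [x] to the nearest face, capped at [1]. *)
pose e := \big[Num.min/1]_(i < n) Num.min (coordn x i - a i) (a i + l - coordn x i).
have xi i : a i < coordn x i < a i + l by have := xO i; rewrite in_itv.
exists e.
  by apply/bigmin_gtP; split => // i _; rewrite lt_min !subr_gt0.
move=> y yx; apply: sub => i; have /ltr_normlP[y1 y2] := yx i.
have ei : e <= Num.min (coordn x i - a i) (a i + l - coordn x i).
  exact: bigmin_le_cond.
move: ei; rewrite le_min => /andP[e1 e2].
rewrite in_itv/=; rewrite -/(coordn y i); lra.
Qed.

Lemma monsum_le_integral (J : finType) c (g : J -> 'I_n -> nat) d Q x :
  cube Q -> (forall j i, g j i < d)%N -> Q x ->
  ((`|monsum c g x| * vol Q)%:E <= ((d * (2 * d + 1) ^ d.+1) ^ n)%:R%:E *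
    \int[mu]_(y in Q) `|monsum c g y|%:E)%E.
Proof.
move=> cQ gd; move: cQ => [a [l [bl [br [l0 ->]]]]].
rewrite -/(box a l bl br) => xQ.
have -> : vol (box a l bl br : set (Rn R n)) = l ^+ n.
  by rewrite /vol lebesgue_borelE ?lebesgue_borel_box//; exact: measurable_box.
rewrite ge0_integral_borel//; first exact: monsum_le_integral_borel.
  exact: measurable_box.
apply: measurable_funTS; apply/measurable_EFinP; apply: measurableT_comp => //.
exact: measurable_monsum.
Qed.

End cubes.

(** * Polynomial functions on a cube *)

Section polynomial_functions.
Context {R : realType} {n : nat}.
Local Notation mu := (lebesgue R n).

(** Coefficients over the finite type of multi-indices of degree at most [s] open the way to
    matrices. *)
Definition pol s (c : mpoly.bmultinom n s.+1 -> R) (x : Rn R n) : R :=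
  \sum_j c j * monom (mpoly.bmnm j) x.

Lemma peval_pol s (P : mpoly.mpoly n R) x : (mpoly.msize P <= s.+1)%N ->
  peval P x = pol (fun j : mpoly.bmultinom n s.+1 => mpoly.mcoeff (mpoly.bmnm j) P) x.
Proof.
move=> sP; rewrite {1}(mpoly.mpolywE sP) /peval raddf_sum.
by apply: eq_bigr => j _; apply: etrans (mpoly.mevalZ _ _ _) _; rewrite mpoly.mevalX.
Qed.

Lemma pol_peval s (c : mpoly.bmultinom n s.+1 -> R) :
  exists2 P : mpoly.mpoly n R, (mpoly.msize P <= s.+1)%N &
    forall x, peval P x = pol c x.
Proof.
exists (\sum_j c j *: mpoly.mpolyX R (mpoly.bmnm j)).
  apply: (big_ind (fun P : mpoly.mpoly n R => mpoly.msize P <= s.+1)%N).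
  - by rewrite mpoly.msize0.
  - move=> P P' sP sP'; apply: (leq_trans (mpoly.msizeD_le _ _)).
    by rewrite geq_max sP.
  - move=> j _; apply: (leq_trans (mpoly.msizeZ_le _ _)).
    by rewrite mpoly.msizeX; exact: mpoly.bmdeg.
move=> x; rewrite /peval raddf_sum.
by apply: eq_bigr => j _; apply: etrans (mpoly.mevalZ _ _ _) _; rewrite mpoly.mevalX.
Qed.

Lemma bmultinom_lt s (j : mpoly.bmultinom n s.+1) i :
  (mpoly.fun_of_multinom (mpoly.bmnm j) i < s.+1)%N.
Proof.
apply: leq_ltn_trans (mpoly.bmdeg j); rewrite mpoly.mdegE.
by rewrite (bigD1 i)//= leq_addr.
Qed.

Lemma cube_bounded (Q : set (Rn R n)) : cube Q -> boundedn Q.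
Proof.
move=> [a [l [bl [br [l0 ->]]]]].
exists (\sum_i `|a i| + l) => x xQ i.
have : a i <= coordn x i <= a i + l.
  by have := xQ i; rewrite itv_boundlr => /andP[];
    case: (bl i); case: (br i); rewrite !bnd_simp => ? ?; apply/andP; split => //; exact: ltW.
have ai : `|a i| <= \sum_i `|a i|.
  by rewrite (bigD1 i)//= lerDl sumr_ge0.
have := ler_norm (a i); have := ler_norm (- a i); rewrite normrN ler_norml; lra.
Qed.

Lemma monom_bounded (Q : set (Rn R n)) (m : mpoly.multinom n) :
  boundedn Q -> [bounded monom m x | x in Q].
Proof.
move=> [M QM]; exists (\prod_(i < n) M ^+ m i); split; first exact: num_real.
move=> y My x Qx /=; apply: le_trans (ltW My).
rewrite /monom normr_prod; apply: ler_prod => i _; rewrite normr_ge0/= normrX.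
by apply: lerXn2r; rewrite ?nnegrE//; have := QM x Qx i => // /(le_trans (normr_ge0 _)).
Qed.

Lemma measurable_monom (m : mpoly.multinom n) (D : set (Rn R n)) :
  measurable_fun D (monom m : Rn R n -> R).
Proof.
apply: measurable_funTS; apply: measurable_prod => i _; apply: measurable_funX.
exact: measurableT_comp (@measurable_tnth _ _ n i) measurable_id_Rn.
Qed.

Lemma integrableM_monom (Q : set (Rn R n)) (f : Rn R n -> R) m : cube Q ->
  mu.-integrable Q (EFin \o f) ->
  mu.-integrable Q (EFin \o (fun x => f x * monom m x)).
Proof.
move=> cQ fi; have [mQ _ _ _] := cubeP cQ.
rewrite (_ : EFin \o _ = (EFin \o monom m) \* (EFin \o f))%E; last first.
  by apply/funext => x /=; rewrite EFinM muleC.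
apply: integrableMr => //; first exact: measurable_monom.
exact/monom_bounded/cube_bounded.
Qed.

Lemma integrable_sumr (Q : set (Rn R n)) (I : Type) (r : seq I) (h : I -> Rn R n -> R) :
  measurable Q ->
  (forall i, mu.-integrable Q (EFin \o h i)) ->
  mu.-integrable Q (EFin \o (fun x => \sum_(i <- r) h i x)).
Proof.
move=> mQ hi; rewrite (_ : EFin \o _ = fun x => \sum_(i <- r) (EFin \o h i) x)%E.
  exact: integrable_sum.
by apply/funext => x /=; rewrite sumEFin.
Qed.

Lemma Rintegral_sum (Q : set (Rn R n)) (I : Type) (r : seq I) (h : I -> Rn R n -> R) :
  measurable Q ->
  (forall i, mu.-integrable Q (EFin \o h i)) ->
  \int[mu]_(x in Q) (\sum_(i <- r) h i x) = \sum_(i <- r) \int[mu]_(x in Q) h i x.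
Proof.
move=> mQ hi; elim: r => [|i r IH].
  under eq_Rintegral do rewrite big_nil.
  by rewrite big_nil Rintegral_cst// mul0r.
under eq_Rintegral do rewrite big_cons.
by rewrite big_cons RintegralD// ?IH//; exact: integrable_sumr.
Qed.

Lemma integrable_cst_cube (Q : set (Rn R n)) (k : R) :
  cube Q -> mu.-integrable Q (EFin \o (fun=> k)).
Proof.
move=> cQ; have [mQ muQ _ _] := cubeP cQ.
apply: measurable_bounded_integrable => //; first by rewrite muQ ltry.
exists `|k|; split; first exact: num_real.
by move=> y ky x _ /=; exact: ltW.
Qed.

Lemma integrable_monom (Q : set (Rn R n)) m :
  cube Q -> mu.-integrable Q (EFin \o monom m).
Proof.
move=> cQ; have := integrableM_monom m cQ (integrable_cst_cube 1 cQ).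
by congr integrable; apply/funext => x /=; rewrite mul1r.
Qed.

Lemma integrableM_pol (Q : set (Rn R n)) s (f : Rn R n -> R)
    (c : mpoly.bmultinom n s.+1 -> R) :
  cube Q ->
  mu.-integrable Q (EFin \o f) ->
  mu.-integrable Q (EFin \o (fun x => f x * pol c x)).
Proof.
move=> cQ fi; have [mQ _ _ _] := cubeP cQ.
rewrite (_ : (fun x => _) = fun x => \sum_j c j * (f x * monom (mpoly.bmnm j) x)).
  apply: integrable_sumr => // j.
  exact: (integrableZl mQ (c j) (integrableM_monom (mpoly.bmnm j) cQ fi)).
apply/funext => x; rewrite mulr_sumr; apply: eq_bigr => j _.
by rewrite mulrCA.
Qed.

Lemma integrable_pol (Q : set (Rn R n)) s (c : mpoly.bmultinom n s.+1 -> R) :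
  cube Q -> mu.-integrable Q (EFin \o pol c).
Proof.
move=> cQ; have := integrableM_pol c cQ (integrable_cst_cube 1 cQ).
by congr integrable; apply/funext => x /=; rewrite mul1r.
Qed.

Lemma Rintegral_mul_pol (Q : set (Rn R n)) s (f : Rn R n -> R)
    (c : mpoly.bmultinom n s.+1 -> R) :
  cube Q ->
  mu.-integrable Q (EFin \o f) ->
  \int[mu]_(x in Q) (f x * pol c x) =
  \sum_j c j * \int[mu]_(x in Q) (f x * monom (mpoly.bmnm j) x).
Proof.
move=> cQ fi; have [mQ _ _ _] := cubeP cQ.
rewrite (_ : (fun x => _) = fun x => \sum_j c j * (f x * monom (mpoly.bmnm j) x)).
  rewrite Rintegral_sum//.
    apply: eq_bigr => j _; rewrite RintegralZl//; exact: integrableM_monom.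
  move=> j.
  exact: (integrableZl mQ (c j) (integrableM_monom (mpoly.bmnm j) cQ fi)).
apply/funext => x; rewrite mulr_sumr; apply: eq_bigr => j _.
by rewrite mulrCA.
Qed.

(** The constant of [monsum_le_integral] for [d = 2 * s + 1], as exponents in the square of a
    polynomial of degree [s] are at most [2 * s]. *)
Definition sup_const s : R :=
  (((2 * s).+1 * (2 * (2 * s).+1 + 1) ^ (2 * s).+2) ^ n)%:R.

(** The supremum bound is applied to the square, so that the right side is an inner product, to
    which orthogonality applies. *)
Lemma sqr_pol_le_Rintegral s (c : mpoly.bmultinom n s.+1 -> R) (Q : set (Rn R n)) x :
  cube Q -> Q x ->
  pol c x ^+ 2 * vol Q <= sup_const s * \int[mu]_(y in Q) (pol c y * pol c y).
Proof.
move=> cQ Qx; have [mQ muQ _ _] := cubeP cQ.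
pose c2 (jk : mpoly.bmultinom n s.+1 * mpoly.bmultinom n s.+1) := c jk.1 * c jk.2.
pose g2 (jk : mpoly.bmultinom n s.+1 * mpoly.bmultinom n s.+1) i :=
  (mpoly.fun_of_multinom (mpoly.bmnm jk.1) i +
   mpoly.fun_of_multinom (mpoly.bmnm jk.2) i)%N.
have sqE y : pol c y * pol c y = monsum c2 g2 y.
  rewrite /pol big_distrlr pair_bigA /=; apply: eq_bigr => jk _.
  rewrite mulrACA; congr (_ * _); rewrite /monom -big_split/=.
  by apply: eq_bigr => i _; rewrite exprD.
have g2d jk i : (g2 jk i < (2 * s).+1)%N.
  by rewrite /g2; have := bmultinom_lt jk.1 i; have := bmultinom_lt jk.2 i; lia.
have := @monsum_le_integral R n _ c2 g2 _ Q x cQ g2d Qx.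
have sq0 y : 0 <= monsum c2 g2 y by rewrite -sqE -expr2 sqr_ge0.
rewrite ger0_norm// -lee_fin expr2 sqE EFinM => /le_trans; apply.
rewrite EFinM; apply: lee_wpmul2l; first by rewrite lee_fin.
have pi := integrableM_pol c cQ (integrable_pol c cQ).
rewrite /Rintegral fineK; last exact: (integrable_fin_num mQ pi).
rewrite le_eqVlt; apply/orP; left; apply/eqP; apply: eq_integral => y _.
by rewrite sqE ger0_norm.
Qed.

End polynomial_functions.
Arguments sup_const {R} n s.

(** * Existence and uniqueness of the projection *)

Section projection.
Context {R : realType} {n : nat}.
Local Notation mu := (lebesgue R n).

(** Definiteness of the inner product of polynomials on [Q]: a vanishing integral of the square
    forces a vanishing supremum. *)
Lemma pol_eq0 s (c : mpoly.bmultinom n s.+1 -> R) (Q : set (Rn R n)) x :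
  cube Q -> \int[mu]_(y in Q) (pol c y * pol c y) = 0 -> Q x -> pol c x = 0.
Proof.
move=> cQ I0 Qx; have [_ _ v0 _] := cubeP cQ.
have := sqr_pol_le_Rintegral c cQ Qx.
rewrite I0 mulr0 pmulr_lle0// => h; apply/eqP; rewrite -sqrf_eq0.
by rewrite eq_le h sqr_ge0.
Qed.

(* The moments of [f] are orthogonal to the kernel of the Gram matrix of the
   monomials: a polynomial in this kernel has zero L^2 norm, hence vanishes
   on the cube. *)
Lemma pol_projection s (f : Rn R n -> R) (Q : set (Rn R n)) : cube Q ->
  mu.-integrable Q (EFin \o f) ->
  exists c : mpoly.bmultinom n s.+1 -> R, forall j : mpoly.bmultinom n s.+1,
    \int[mu]_(x in Q) ((f x - pol c x) * monom (mpoly.bmnm j) x) = 0.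
Proof.
move=> cQ fi; have [mQ _ _ _] := cubeP cQ.
pose J : finType := mpoly.bmultinom n s.+1.
pose m (j : J) : Rn R n -> R := monom (mpoly.bmnm j).
have mi j : mu.-integrable Q (EFin \o m j) by exact: integrable_monom.
pose G := \matrix_(i < #|J|, k < #|J|)
  \int[mu]_(x in Q) (m (enum_val k) x * m (enum_val i) x).
pose b := \row_(k < #|J|) \int[mu]_(x in Q) (f x * m (enum_val k) x).
have sumJ (F : J -> R) : \sum_j F j = \sum_(k < #|J|) F (enum_val k).
  by rewrite -(big_enum_val F); apply: eq_bigl.
have mom (h : Rn R n -> R) c : mu.-integrable Q (EFin \o h) ->
    \int[mu]_(x in Q) (h x * pol c x) =
    \sum_(k < #|J|) c (enum_val k) * \int[mu]_(x in Q) (h x * m (enum_val k) x).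
  by move=> hi; rewrite Rintegral_mul_pol// sumJ.
have /submxP[u bE] : (b <= G)%MS.
  (* Membership in the row space is tested on the columns of the cokernel; column [k] provides the
     coefficients [w] of a polynomial. *)
  rewrite submxE; apply/eqP/rowP => k; rewrite [in RHS]mxE.
  pose w (j : J) := cokermx G (enum_rank j) k.
  have Gw (i : 'I_#|J|) : \int[mu]_(x in Q) (m (enum_val i) x * pol w x) = 0.
    rewrite mom//.
    have /matrixP/(_ i k) := mulmx_coker G; rewrite !mxE => GE.
    rewrite -[RHS]GE; apply: eq_bigr => j _.
    rewrite /w enum_valK [G _ _]mxE mulrC; congr (_ * _).
    by apply: eq_Rintegral => x _; rewrite mulrC.
  (* [pol w] is a combination of monomials orthogonal to it, so the integral of its square
     vanishes. *)
  have w0 x : Q x -> pol w x = 0.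
    apply: pol_eq0 => //; rewrite mom; last exact: integrable_pol.
    apply: big1 => j _.
    under eq_Rintegral do rewrite mulrC.
    by rewrite Gw mulr0.
  have := mom f w fi.
  have -> : \int[mu]_(x in Q) (f x * pol w x) = 0.
    transitivity (\int[mu]_(x in Q) (0 : R)); last by rewrite Rintegral_cst ?mul0r.
    by apply: eq_Rintegral => x; rewrite inE => Qx; rewrite w0// mulr0.
  move=> /esym bw; rewrite mxE -[RHS]bw; apply: eq_bigr => j _.
  by rewrite /w enum_valK [b _ _]mxE mulrC.
pose c (j : mpoly.bmultinom n s.+1) := u 0 (enum_rank j); exists c => j.
have -> : \int[mu]_(x in Q) ((f x - pol c x) * m j x) =
    \int[mu]_(x in Q) (f x * m j x) - \int[mu]_(x in Q) (m j x * pol c x).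
  rewrite -RintegralB//; last 2 first.
  - exact: integrableM_monom.
  - exact: integrableM_pol.
  by apply: eq_Rintegral => x _; rewrite mulrBl [pol c x * _]mulrC.
apply/eqP; rewrite subr_eq0; apply/eqP.
have /rowP/(_ (enum_rank j)) := bE; rewrite !mxE enum_rankK => ->.
rewrite mom//; apply: eq_bigr => i _.
rewrite /c enum_valK mxE enum_rankK; congr (_ * _).
Qed.

Lemma polyproj_exists s (f : Rn R n -> R) (Q : set (Rn R n)) : cube Q ->
  mu.-integrable Q (EFin \o f) -> is_polyproj s Q f (polyproj s Q f).
Proof.
move=> cQ fi; have [c cP] := pol_projection s cQ fi.
have [P sP PE] := pol_peval c.
apply: (@xgetPex _ 0 (is_polyproj s Q f)); exists P; split => // gamma sg.
rewrite -[RHS](cP (mpoly.BMultinom (sg : (mpoly.mdeg gamma < s.+1)%N))).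
by apply: eq_Rintegral => x _; rewrite PE.
Qed.

Lemma integrable_peval (P : mpoly.mpoly n R) (Q : set (Rn R n)) : cube Q ->
  mu.-integrable Q (EFin \o peval P).
Proof.
move=> cQ; have := integrable_pol (fun j : mpoly.bmultinom n (mpoly.msize P).+1 =>
  mpoly.mcoeff (mpoly.bmnm j) P) cQ.
congr integrable; apply/funext => x /=.
by rewrite (peval_pol _ (leqnSn _)).
Qed.

Lemma is_polyproj_orthogonal s (f : Rn R n -> R) (Q : set (Rn R n)) P
    (P' : mpoly.mpoly n R) :
  cube Q -> mu.-integrable Q (EFin \o f) -> is_polyproj s Q f P ->
  (mpoly.msize P' <= s.+1)%N ->
  \int[mu]_(x in Q) ((f x - peval P x) * peval P' x) = 0.
Proof.
move=> cQ fi [sP fP] sP'; have [mQ _ _ _] := cubeP cQ.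
under eq_Rintegral do rewrite (peval_pol _ sP').
rewrite (@Rintegral_mul_pol _ _ _ _ (fun x => f x - peval P x))//.
  apply: big1 => j _; have jd : (mpoly.mdeg (mpoly.bmnm j) <= s)%N by exact: mpoly.bmdeg j.
  by rewrite fP// mulr0.
rewrite (_ : EFin \o _ = (EFin \o f) \- (EFin \o peval P))%E//.
by apply: integrableB => //; exact: integrable_peval.
Qed.

(** The difference [P - P'] is orthogonal to both [f - P] and [f - P'], hence to itself. *)
Lemma is_polyproj_unique s (f : Rn R n -> R) (Q : set (Rn R n)) P P' x :
  cube Q -> mu.-integrable Q (EFin \o f) ->
  is_polyproj s Q f P -> is_polyproj s Q f P' -> Q x -> peval P x = peval P' x.
Proof.
move=> cQ fi fP fP' Qx; have [mQ _ _ _] := cubeP cQ.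
have sD : (mpoly.msize (P - P') <= s.+1)%N.
  apply: (leq_trans (mpoly.msizeD_le _ _)); rewrite mpoly.msizeN geq_max.
  by rewrite fP.1 fP'.1.
have DE y : peval (P - P') y = peval P y - peval P' y by exact: mpoly.mevalB.
apply/eqP; rewrite -subr_eq0 -DE; apply/eqP; rewrite (peval_pol _ sD).
apply: (pol_eq0 cQ _ Qx).
have := is_polyproj_orthogonal cQ fi fP sD.
have := is_polyproj_orthogonal cQ fi fP' sD.
have int (P0 : mpoly.mpoly n R) : mu.-integrable Q
    (EFin \o (fun y => (f y - peval P0 y) * peval (P - P') y)).
  rewrite (_ : (fun y => _) = fun y => (f y - peval P0 y) *
      pol (fun j : mpoly.bmultinom n s.+1 => mpoly.mcoeff (mpoly.bmnm j) (P - P')) y).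
    apply: integrableM_pol => //.
    rewrite (_ : EFin \o _ = (EFin \o f) \- (EFin \o peval P0))%E//.
    by apply: integrableB => //; exact: integrable_peval.
  by apply/funext => y; rewrite -peval_pol.
move=> e1 e2; transitivity (\int[mu]_(y in Q) ((f y - peval P' y) * peval (P - P') y) -
  \int[mu]_(y in Q) ((f y - peval P y) * peval (P - P') y)); last first.
  by rewrite e1 e2 subrr.
rewrite -RintegralB//; apply: eq_Rintegral => y _.
rewrite -mulrBl -!peval_pol//; congr (_ * _).
by rewrite DE; ring.
Qed.

End projection.

(** * Uniform bound for projections, and projections of consecutive degrees *)

Section projection_bound.
Context {R : realType} {n : nat}.
Local Notation mu := (lebesgue R n).

Lemma integrable_sub_peval (f : Rn R n -> R) (Q : set (Rn R n))
    (P : mpoly.mpoly n R) : cube Q ->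
  mu.-integrable Q (EFin \o f) ->
  mu.-integrable Q (EFin \o (fun x => f x - peval P x)).
Proof.
move=> cQ fi; have [mQ _ _ _] := cubeP cQ.
rewrite (_ : EFin \o _ = (EFin \o f) \- (EFin \o peval P))%E//.
by apply: integrableB => //; exact: integrable_peval.
Qed.

Lemma integrableM_peval (f : Rn R n -> R) (Q : set (Rn R n))
    (P : mpoly.mpoly n R) : cube Q ->
  mu.-integrable Q (EFin \o f) ->
  mu.-integrable Q (EFin \o (fun x => f x * peval P x)).
Proof.
move=> cQ fi.
have := integrableM_pol (fun j : mpoly.bmultinom n (mpoly.msize P).+1 =>
  mpoly.mcoeff (mpoly.bmnm j) P) cQ fi.
by congr integrable; apply/funext => x /=; rewrite (peval_pol _ (leqnSn _)).
Qed.

Lemma sqr_peval_le_Rintegral s (P : mpoly.mpoly n R) (Q : set (Rn R n)) x :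
  cube Q -> (mpoly.msize P <= s.+1)%N -> Q x ->
  peval P x ^+ 2 * vol Q <=
    sup_const n s * \int[mu]_(y in Q) (peval P y * peval P y).
Proof.
move=> cQ sP Qx; rewrite (peval_pol _ sP).
under eq_Rintegral do rewrite (peval_pol _ sP).
exact: sqr_pol_le_Rintegral.
Qed.

(* [int P^2 = int f P <= sup |P| int |f|], and [sup |P|^2] is bounded by a
   constant times the average of [P^2]. *)
Lemma polyproj_bound_exists s : exists C : R, polyproj_bound n s C.
Proof.
exists (Num.max 1 (sup_const n s)); split; first by rewrite le_max lexx.
move=> Q f cQ fi x Qx; have [mQ muQ v0 _] := cubeP cQ.
set P := polyproj s Q f; have fP := polyproj_exists s cQ fi : is_polyproj s Q f P.
have sP := fP.1.
have K0 : 0 <= sup_const n s :> R by rewrite /sup_const ler0n.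
set I2 := \int[mu]_(y in Q) (peval P y * peval P y).
have I2E : I2 = \int[mu]_(y in Q) (f y * peval P y).
  apply/eqP; rewrite eq_sym -subr_eq0 -RintegralB//; last 2 first.
  - exact: integrableM_peval.
  - by apply: integrableM_peval => //; exact: integrable_peval.
  apply/eqP; rewrite -[RHS](is_polyproj_orthogonal cQ fi fP sP).
  by apply: eq_Rintegral => y _; rewrite mulrBl.
pose S := [set `|peval P y| | y in Q].
(* A crude bound from [t <= 1 + t^2]; it serves to make the supremum [M] meaningful. *)
have Sub : ubound S (1 + sup_const n s * I2 / vol Q).
  move=> _ [y Qy <-].
  have := sqr_peval_le_Rintegral cQ sP Qy; rewrite -ler_pdivlMr// -/I2.
  rewrite -[peval P y ^+ 2]real_normK ?num_real// => h.
  have := sqr_ge0 (`|peval P y| - 1); have := sqr_ge0 `|peval P y|; nra.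
have Ssup : has_sup S by split; [exists `|peval P x|, x|exists (1 + sup_const n s * I2 / vol Q)].
set M := sup S.
have PM y : Q y -> `|peval P y| <= M by move=> Qy; apply: ub_le_sup => //; [exact: Ssup.2|exists y].
have M0 : 0 <= M by apply: le_trans (PM x Qx).
set A := (_^-1 * _).
have A0 : 0 <= A by rewrite mulr_ge0 ?invr_ge0 ?(ltW v0)//; apply: Rintegral_ge0.
have nfi : mu.-integrable Q (EFin \o (fun y => `|f y|)) by exact: integrable_norm.
have I2M : I2 <= M * (vol Q * A).
  rewrite /A mulVKf ?gt_eqF// I2E -RintegralZl//.
  apply: le_Rintegral => //; first exact: integrableM_peval.
    exact: (integrableZl mQ M nfi).
  move=> y Qy; rewrite (le_trans (ler_norm _))// normrM mulrC ler_wpM2r// PM//.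
have PMA y : Q y -> `|peval P y| <= Num.sqrt (sup_const n s * (M * A)).
  move=> Qy; rewrite -sqrtr_sqr; apply: ler_wsqrtr.
  rewrite -(ler_pM2r v0); apply: (le_trans (sqr_peval_le_Rintegral cQ sP Qy)).
  rewrite -mulrA ler_wpM2l// (le_trans I2M)//; lra.
have KMA0 : 0 <= sup_const n s * (M * A).
  by apply: mulr_ge0 => //; exact: mulr_ge0.
have : M <= Num.sqrt (sup_const n s * (M * A)).
  by apply: ge_sup => [|_ [y Qy <-]]; [exact: Ssup.1|exact: PMA].
(* Squaring gives [M^2] at most [sup_const n s * M * A], and [M] cancels unless it is zero. *)
rewrite -(ler_pXn2r (ltn0Sn 1)) ?nnegrE ?sqrtr_ge0// sqr_sqrtr//.
move=> MKA; apply: (le_trans (PM x Qx)).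
apply: (@le_trans _ _ (sup_const n s * A)); last first.
  by rewrite ler_wpM2r// le_max lexx orbT.
have [->|Mn0] := eqVneq M 0; first by rewrite mulr_ge0.
rewrite -(@ler_pM2l _ M) ?lt_def ?Mn0//; move: MKA; rewrite expr2; lra.
Qed.

(** The residual is unchanged: [(f - P') - (P - P') = f - P]. *)
Lemma is_polyproj_sub s t (f : Rn R n -> R) (Q : set (Rn R n)) P P' :
  (s <= t)%N -> is_polyproj t Q f P -> (mpoly.msize P' <= s.+1)%N ->
  is_polyproj t Q (fun x => f x - peval P' x) (P - P').
Proof.
move=> st [sP fP] sP'; split.
  apply: (leq_trans (mpoly.msizeD_le _ _)); rewrite mpoly.msizeN geq_max sP.
  exact: leq_trans sP' _.
move=> gamma sg; rewrite -[RHS](fP gamma sg); apply: eq_Rintegral => x _.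
congr (_ * _); rewrite (_ : peval (P - P') x = peval P x - peval P' x); first ring.
exact: mpoly.mevalB.
Qed.

(* The mean of [|f| - P] vanishes and [||f| - P| <= 2 |f - P| + (|f| - P)]. *)
Lemma Rintegral_abs_sub_polyproj s (f : Rn R n -> R) (Q : set (Rn R n)) P :
  cube Q -> mu.-integrable Q (EFin \o f) ->
  is_polyproj s Q (fun x => `|f x|) P ->
  \int[mu]_(x in Q) `| `|f x| - peval P x | <=
    2 * \int[mu]_(x in Q) `|f x - peval P x|.
Proof.
move=> cQ fi [sP fP]; have [mQ _ _ _] := cubeP cQ.
have nfi : mu.-integrable Q (EFin \o (fun y => `|f y|)) by exact: integrable_norm.
have gi := integrable_sub_peval P cQ fi.
have ngi : mu.-integrable Q (EFin \o (fun x => `|f x - peval P x|)).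
  exact: integrable_norm gi.
have hi := integrable_sub_peval P cQ nfi.
have : \int[mu]_(x in Q) (`|f x| - peval P x) = 0.
  (* The zero multi-index gives the mean. *)
  rewrite -[RHS](fP mpoly.mnm0) ?mpoly.mdeg0//; apply: eq_Rintegral => x _.
  by rewrite /monom big1 ?mulr1// => i _; rewrite mpoly.mnm0E expr0.
rewrite -[leRHS]addr0 => <-; rewrite -RintegralZl// -RintegralD//; last first.
  exact: (integrableZl mQ 2 ngi).
apply: le_Rintegral => //.
- exact: integrable_norm hi.
- rewrite (_ : EFin \o _ =
      (fun x => 2%:E * (`|f x - peval P x|)%:E) \+ (EFin \o (fun x => `|f x| - peval P x)%R))%E//.
  by apply: integrableD => //; exact: (integrableZl mQ 2 ngi).
(* The pointwise bound rests on [|f| - P >= f - P >= - |f - P|]. *)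
move=> x _; have := ler_norm (f x); have := ler_norm (peval P x - f x).
rewrite distrC => h1 h2; rewrite ler_norml; have := normr_ge0 (f x - peval P x).
move=> h3; apply/andP; split; lra.
Qed.

(** By uniqueness [P1 - P] agrees on [Q] with the chosen projection of [|f| - P], to which the
    constant [C] applies. *)
Lemma polyproj_succ_diff s C (f : Rn R n -> R) (Q : set (Rn R n)) P P1 x :
  polyproj_bound n s.+1 C -> cube Q -> mu.-integrable Q (EFin \o f) -> Q x ->
  is_polyproj s Q (fun y => `|f y|) P ->
  is_polyproj s.+1 Q (fun y => `|f y|) P1 ->
  `|peval P1 x - peval P x| <=
    2 * C * ((vol Q)^-1 * \int[mu]_(y in Q) `|f y - peval P y|).
Proof.
move=> [C1 CP] cQ fi Qx Ps Ps1; have [mQ muQ v0 _] := cubeP cQ.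
have nfi : mu.-integrable Q (EFin \o (fun y => `|f y|)) by exact: integrable_norm.
have hi := integrable_sub_peval P cQ nfi.
have := is_polyproj_unique cQ hi (polyproj_exists s.+1 cQ hi)
  (is_polyproj_sub (leqnSn s) Ps1 Ps.1) Qx.
rewrite (_ : peval (P1 - P) x = peval P1 x - peval P x); last first.
  exact: mpoly.mevalB.
move=> <-; apply: (le_trans (CP _ _ cQ hi _ Qx)).
have := Rintegral_abs_sub_polyproj cQ fi Ps.
have C0 : 0 <= C by rewrite (le_trans _ C1).
move=> h; rewrite [2 * C]mulrC -mulrA; apply: ler_wpM2l => //.
by rewrite mulrCA; apply: ler_wpM2l => //; rewrite invr_ge0 ltW.
Qed.

End projection_bound.

(** * Tangent line and convexity inequalities for powers *)

Section power_means.
Context {R : realType}.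

Lemma le_poweR2l (r : R) (x y : \bar R) :
  0 <= r -> (0 <= x)%E -> (x <= y)%E -> (x `^ r <= y `^ r)%E.
Proof.
move=> r0 x0 xy; apply: gt0_ler_poweR => //.
  by rewrite in_itv/= x0 leey.
by rewrite in_itv/= leey andbT (le_trans x0).
Qed.

(** Young's inequality for the theta-th power of [t] and [1], with exponents [theta^-1] and
    [(1 - theta)^-1]; the case [theta = 1] is apart, its conjugate exponent being infinite. *)
Lemma powR_tangent (t theta : R) : 0 <= t -> 0 < theta <= 1 ->
  t `^ theta <= 1 - theta + theta * t.
Proof.
move=> t0 /andP[th0]; rewrite le_eqVlt => /predU1P[->|th1].
  by rewrite powRr1// subrr add0r mul1r.
have := @conjugate_powR R (t `^ theta) 1 theta^-1 (1 - theta)^-1.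
rewrite !invrK powR1 /= => /(_ (powR_ge0 _ _) ler01).
rewrite !invr_gt0 subr_gt0 addrC subrK => /(_ th0 th1 erefl).
by rewrite mulr1 -powRrM divff ?gt_eqF// powRr1// mul1r addrC mulrC.
Qed.

(** The tangent line at [lam] of the power of exponent [r / r'], evaluated at the [r']-th power of
    [x]. *)
Lemma poweR_tangent (x : \bar R) (r r' lam : R) : (0 <= x)%E ->
  0 < r -> r <= r' -> 0 < lam ->
  (x `^ r <= (lam `^ (r / r') * (1 - r / r'))%:E +
     (lam `^ (r / r') * (r / r') / lam)%:E * x `^ r')%E.
Proof.
move=> x0 r0 rr' lam0; have r'0 : 0 < r' by exact: lt_le_trans rr'.
have th : 0 < r / r' <= 1 by rewrite divr_gt0//= ler_pdivrMr ?mul1r.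
have /andP[th0 th1] := th.
have lth : 0 < lam `^ (r / r') by exact: powR_gt0.
case: x x0 => [x|_|//]; last first.
  have c0 : (0 < (lam `^ (r / r') * (r / r') / lam)%:E)%E.
    by rewrite lte_fin divr_gt0// mulr_gt0.
  by rewrite !poweRyr ?gt_eqF// (gt0_muley c0).
rewrite lee_fin => x0; rewrite !poweR_EFin -EFinM -EFinD lee_fin.
have -> : x `^ r = lam `^ (r / r') * (x `^ r' / lam) `^ (r / r').
  rewrite -powRM ?divr_ge0 ?(ltW lam0) ?powR_ge0//.
  by rewrite mulrCA divff ?gt_eqF// mulr1 -powRrM mulrC divfK ?gt_eqF.
have := @powR_tangent (x `^ r' / lam) _ (divr_ge0 (powR_ge0 _ _) (ltW lam0)) th.
move=> /(ler_wpM2l (ltW lth))/le_trans; apply.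
by rewrite mulrDr lerD2l !mulrA mulrAC.
Qed.

(* The bound in [lam] is optimal at [lam = S / V]; it is approached from above
   to allow [S = 0]. *)
Lemma power_mean_bound (theta V S : R) (I : \bar R) :
  0 < theta <= 1 -> 0 < V -> 0 <= S ->
  (forall lam : R, 0 < lam ->
    (I <= (lam `^ theta * (1 - theta) * V + lam `^ theta * theta / lam * S)%:E)%E) ->
  (I <= (V `^ (1 - theta) * S `^ theta)%:E)%E.
Proof.
move=> th V0; have /andP[th0 th1] := th.
rewrite le_eqVlt => /predU1P[<-|S0] H.
  rewrite powR0 ?gt_eqF// mulr0; apply/lee_addgt0Pr => e e0; rewrite add0e.
  (* For this [lam], its theta-th power times [V] equals [e]. *)
  have := H ((e / V) `^ theta^-1) (powR_gt0 _ (divr_gt0 e0 V0)).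
  rewrite mulr0 addr0 -powRrM mulVf ?gt_eqF// powRr1 ?divr_ge0 ?(ltW e0) ?(ltW V0)//.
  move=> /le_trans; apply; rewrite lee_fin mulrAC divfK ?gt_eqF//.
  by rewrite ler_piMr ?(ltW e0)// lerBlDr lerDl ltW.
have := H (S / V) (divr_gt0 S0 V0) => /le_trans; apply.
rewrite lee_fin.
have -> : (S / V) `^ theta * theta / (S / V) * S = (S / V) `^ theta * theta * V.
  by field; rewrite !gt_eqF.
rewrite -!mulrA -mulrDr -mulrDl subrK mul1r.
rewrite powRM ?invr_ge0 ?(ltW S0) ?(ltW V0)//.
rewrite powRB ?(gt_eqF V0) ?implybT// powRr1 ?(ltW V0)//.
rewrite -powR_inv1 ?(ltW V0)// -powRrM mulN1r powRN.
by rewrite mulrC [X in _ <= X]mulrC mulrCA mulrA.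
Qed.

(** Convexity of the r-th power at [u] and [a] with weights [1 / (1 + k)] and [k / (1 + k)], after
    division by [1 + k]. *)
Lemma powR_addl_le (u a k r : R) : 0 <= u -> 0 <= a -> 0 <= k -> 1 <= r ->
  (u + k * a) `^ r <= (1 + k) `^ (r - 1) * (u `^ r + k * a `^ r).
Proof.
move=> u0 a0 k0 r1; have k1 : 0 < 1 + k by rewrite ltr_pwDl.
have t01 : 0 <= (1 + k)^-1 <= 1.
  by rewrite invr_ge0 (ltW k1)/= invf_le1// lerDl.
have /andP[t0 t1] := t01.
have := @convex_powR R r r1 (Itv01 t0 t1) u a.
rewrite !inE/= !in_itv/= !andbT => /(_ u0 a0).
rewrite [X in X `^ _]convRE !convRE/= /unstable.onem.
have -> : (1 + k)^-1 * u + (1 - (1 + k)^-1) * a = (u + k * a) / (1 + k).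
  by field; rewrite gt_eqF.
rewrite (_ : 1 - (1 + k)^-1 = k / (1 + k)); last first.
  by field; rewrite gt_eqF.
rewrite powRM ?addr_ge0 ?mulr_ge0 ?invr_ge0 ?(ltW k1)//.
rewrite -powR_inv1 ?(ltW k1)// -powRrM mulN1r powRN powR_inv1 ?(ltW k1)//.
rewrite ler_pdivrMr ?powR_gt0// => /le_trans; apply.
rewrite powRB ?(gt_eqF k1) ?implybT// powRr1 ?(ltW k1)//.
by rewrite le_eqVlt; apply/orP; left; apply/eqP; field; rewrite gt_eqF.
Qed.

End power_means.

(** * Integrals of powers of a function *)

Section power_integrals.
Context d (T : measurableType d) (R : realType) (mu : {measure set T -> \bar R}).
Variables (D : set T) (mD : measurable D).
Implicit Types f g h : T -> R.

Lemma measurable_powR_abs f r : measurable_fun D f ->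
  measurable_fun D (fun x => (`|f x| `^ r)%:E : \bar R).
Proof.
move=> mf; apply/measurable_EFinP.
apply: (@measurableT_comp _ _ _ _ _ _ (fun x : R => x `^ r)).
  exact: measurable_powR.
exact: measurableT_comp mf.
Qed.

Lemma integral_powR_abs_ge0 f r : (0 <= \int[mu]_(x in D) (`|f x| `^ r)%:E)%E.
Proof. by apply: integral_ge0 => x _; rewrite lee_fin powR_ge0. Qed.

(** The tangent line at [lam] is integrated over [D], and [power_mean_bound] removes [lam]. *)
Lemma integral_powR_le f (r r' V S : R) : measurable_fun D f ->
  mu D = V%:E -> 0 < V -> 0 < r -> r <= r' ->
  (\int[mu]_(x in D) (`|f x| `^ r')%:E = S%:E)%E ->
  (\int[mu]_(x in D) (`|f x| `^ r)%:E <=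
    (V `^ (1 - r / r') * S `^ (r / r'))%:E)%E.
Proof.
move=> mf muD V0 r0 rr' IS; have r'0 : 0 < r' by exact: lt_le_trans rr'.
have th : 0 < r / r' <= 1 by rewrite divr_gt0//= ler_pdivrMr ?mul1r.
have /andP[th0 th1] := th.
have mfr t := measurable_powR_abs t mf.
have fr0 t x : (0 <= (`|f x| `^ t)%:E)%E by rewrite lee_fin powR_ge0.
have S0 : 0 <= S by rewrite -lee_fin -IS; exact: integral_powR_abs_ge0.
apply: power_mean_bound => // lam lam0.
have la0 : 0 <= lam `^ (r / r') by exact: powR_ge0.
have A0 : 0 <= lam `^ (r / r') * (1 - r / r') by rewrite mulr_ge0// subr_ge0.
have B0 : 0 <= lam `^ (r / r') * (r / r') / lam.
  by rewrite divr_ge0 ?(ltW lam0)// mulr_ge0// ltW.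
apply: (@le_trans _ _ (\int[mu]_(x in D)
    ((lam `^ (r / r') * (1 - r / r'))%:E +
     (lam `^ (r / r') * (r / r') / lam)%:E * (`|f x| `^ r')%:E))%E).
  apply: ge0_le_integral => //.
  - by apply: emeasurable_funD => //; exact: measurable_funeM.
  - move=> x _; have := @poweR_tangent R `|f x|%:E r r' lam _ r0 rr' lam0.
    by rewrite !poweR_EFin; apply; rewrite lee_fin.
rewrite ge0_integralD//; last 2 first.
- by move=> x _; rewrite mule_ge0.
- exact: measurable_funeM.
rewrite integral_cst// ge0_integralZl_EFin// muD IS.
by rewrite -!EFinM -EFinD.
Qed.

Lemma integral_powR_perturb g h (r k a V S : R) :
  measurable_fun D g -> measurable_fun D h -> mu D = V%:E ->
  1 <= r -> 0 <= k -> 0 <= a ->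
  (\int[mu]_(x in D) (`|g x| `^ r)%:E = S%:E)%E ->
  (forall x, D x -> `|h x| <= `|g x| + k * a) ->
  (\int[mu]_(x in D) (`|h x| `^ r)%:E <=
    ((1 + k) `^ (r - 1) * (S + k * a `^ r * V))%:E)%E.
Proof.
move=> mg mh muD r1 k0 a0 IS hg; have r0 : 0 < r by exact: lt_le_trans r1.
have c0 : 0 <= (1 + k) `^ (r - 1) by exact: powR_ge0.
have kar0 : (0 <= (k * a `^ r)%:E)%E by rewrite lee_fin mulr_ge0 ?powR_ge0.
have mgr := measurable_powR_abs r mg.
have mhr := measurable_powR_abs r mh.
have gr0 x : (0 <= (`|g x| `^ r)%:E)%E by rewrite lee_fin powR_ge0.
have hr0 x : (0 <= (`|h x| `^ r)%:E)%E by rewrite lee_fin powR_ge0.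
apply: (@le_trans _ _ (\int[mu]_(x in D) (((1 + k) `^ (r - 1))%:E *
    ((`|g x| `^ r)%:E + (k * a `^ r)%:E)))%E).
  apply: ge0_le_integral => //.
  - by apply: measurable_funeM; apply: emeasurable_funD.
  - move=> x Dx.
    suff : `|h x| `^ r <= (1 + k) `^ (r - 1) * (`|g x| `^ r + k * a `^ r) by [].
    apply: le_trans (powR_addl_le _ a0 k0 _) => //.
    by apply: ge0_ler_powR; rewrite ?nnegrE ?(ltW r0)// ?hg// addr_ge0// mulr_ge0.
rewrite ge0_integralZl_EFin//; last 2 first.
- by move=> x _; rewrite adde_ge0.
- exact: emeasurable_funD.
rewrite ge0_integralD//.
rewrite integral_cst// muD IS; exact: lexx.
Qed.

Lemma integral_powR_ae_le f (r y V : R) : measurable_fun D f -> mu D = V%:E ->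
  0 <= r -> 0 <= y -> {ae mu, forall x, D x -> `|f x| <= y} ->
  (\int[mu]_(x in D) (`|f x| `^ r)%:E <= (y `^ r * V)%:E)%E.
Proof.
move=> mf muD r0 y0 fy.
apply: (@le_trans _ _ (\int[mu]_(x in D) (y `^ r)%:E)%E).
  have mfr := measurable_powR_abs r mf.
  apply: ae_ge0_le_integral => //.
    by move=> x _; rewrite lee_fin powR_ge0.
  apply: filterS fy => x fxy Dx; rewrite lee_fin.
  by apply: ge0_ler_powR; rewrite ?nnegrE//; exact: fxy.
by rewrite integral_cst// muD.
Qed.

(** The r-th power of [|f|] is at most [1] plus its [r']-th power. *)
Lemma integral_powR_lty f (r r' : R) : measurable_fun D f -> (mu D < +oo)%E ->
  0 < r -> r <= r' -> (\int[mu]_(x in D) (`|f x| `^ r')%:E < +oo)%E ->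
  (\int[mu]_(x in D) (`|f x| `^ r)%:E < +oo)%E.
Proof.
move=> mf muD r0 rr' fr'.
have mfr t := measurable_powR_abs t mf.
have fr0 t x : (0 <= (`|f x| `^ t)%:E)%E by rewrite lee_fin powR_ge0.
apply: (@le_lt_trans _ _ (\int[mu]_(x in D) (1 + (`|f x| `^ r')%:E))%E).
  apply: ge0_le_integral => //.
    by apply: emeasurable_funD.
  move=> x _; suff : `|f x| `^ r <= 1 + `|f x| `^ r' by [].
  have [f1|f1] := leP 1 `|f x|.
    by rewrite (le_trans (ler_powR f1 rr'))// lerDr.
  rewrite -[leLHS]addr0 lerD ?powR_ge0//.
  have -> : 1 = 1 `^ r :> R by rewrite powR1.
  apply: ge0_ler_powR; rewrite ?nnegrE ?(ltW r0)//.
  exact: ltW.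
rewrite ge0_integralD// integral_cst// mul1e.
by rewrite lte_add_pinfty.
Qed.

Lemma Lnorm_indic_lty f r : 0 < r ->
  (('N[mu]_(r%:E)[(fun x => (f x * \1_D x)%:E)] < +oo) <->
   (\int[mu]_(x in D) (`|f x| `^ r)%:E < +oo))%E.
Proof.
move=> r0.
have -> : ('N[mu]_(r%:E)[(fun x => (f x * \1_D x)%:E)] =
    (\int[mu]_(x in D) (`|f x| `^ r)%:E) `^ r^-1)%E.
  rewrite unlock; congr (_ `^ _)%E; rewrite [RHS]integral_mkcond.
  apply: eq_integral => x _; rewrite patchE indicE.
  case: ifP => _; first by rewrite mulr1; exact: poweR_EFin.
  by rewrite mulr0 abse0 poweR0r ?gt_eqF.
split; last exact: poweR_lty.
by apply: lty_poweRy; rewrite gt_eqF ?invr_gt0.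
Qed.

(** The positive total measure selects the essential supremum in the definition of the norm for the
    exponent [+oo]. *)
Lemma Lnormy_indic_ae f : (0 < mu setT)%E ->
  ('N[mu]_+oo[(fun x => (f x * \1_D x)%:E)] < +oo)%E ->
  exists2 M : R, 0 <= M & {ae mu, forall x, D x -> `|f x| <= M}.
Proof.
move=> mu0; rewrite unlock ifT//.
set e := ess_sup _ _ => ey; exists `|fine e| => //.
have := ess_sup_ge mu (abse \o (fun x => (f x * \1_D x)%:E)).
apply: filterS => x /=; rewrite -/e => fe Dx.
have : (`|f x|%:E <= e)%E.
  by apply: le_trans fe; rewrite indicE mem_set// mulr1.
move: ey; case: e {fe} => [e _|//|_]; last by rewrite leeNy_eq.
by rewrite lee_fin => /le_trans; apply; rewrite ler_norm.
Qed.

End power_integrals.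

(** * Averages over a cube *)

Section averages.
Context {R : realType} {n : nat}.
Local Notation mu := (lebesgue R n).
Implicit Types (Q : set (Rn R n)) (g h : Rn R n -> R).

(** A negative bound would fail on all of [Q], which is not negligible. *)
Lemma ae_le_ge0 Q g (y : \bar R) : cube Q ->
  {ae mu, forall x, Q x -> (`|g x|%:E <= y)%E} -> (0 <= y)%E.
Proof.
move=> cQ [A [mA A0 QA]]; have [mQ muQ v0 _] := cubeP cQ.
rewrite leNgt; apply/negP => y0.
have : (mu Q <= mu A)%E.
  apply: le_measure; rewrite ?inE// => x Qx; apply: QA => /= /(_ Qx) /le_lt_trans.
  by move=> /(_ _ y0); rewrite lte_fin ltNge normr_ge0.
by rewrite A0 muQ lee_fin leNgt v0.
Qed.

Lemma avg_ge0 q Q g : cube Q -> (0 <= avg q Q g)%E.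
Proof.
move=> cQ; case: q => [r| |]//=; first exact: poweR_ge0.
by apply: le_ereal_inf_tmp => y; exact: ae_le_ge0.
Qed.

(** For finite exponents this is [integral_powR_le], the powers of the volume cancelling after
    normalization. For [q = +oo], every almost everywhere bound [y] of [|g|] also bounds its
    [p]-average. *)
Lemma avg_le p q Q g : cube Q -> measurable_fun Q g -> (1 <= p)%E ->
  (p <= q)%E -> (avg p Q g <= avg q Q g)%E.
Proof.
move=> cQ mg p1 pq; have [mQ muQ v0 _] := cubeP cQ.
have vi0 : 0 <= (vol Q)^-1 by rewrite invr_ge0 ltW.
case: p p1 pq => [r r1 rq|_|//]; last by rewrite leye_eq => /eqP ->.
have r0 : 0 < r by rewrite (lt_le_trans ltr01)// -lee_fin.
have vI0 : (0 <= (vol Q)^-1%:E * \int[mu]_(x in Q) (`|g x| `^ r)%:E)%E.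
  by apply: mule_ge0; [rewrite lee_fin|exact: integral_powR_abs_ge0].
case: q rq => [r'|_|]; last by rewrite leeNy_eq.
- rewrite lee_fin => rr'; have r'0 : 0 < r' by exact: lt_le_trans rr'.
  rewrite /avg; set I' := (\int[mu]_(x in Q) (`|g x| `^ r')%:E)%E.
  have I'0 : (0 <= I')%E by exact: integral_powR_abs_ge0.
  case: (ltP I' +oo%E) => [I'y|]; last first.
    rewrite leye_eq => /eqP ->.
    have vi : (0 < (vol Q)^-1%:E)%E by rewrite lte_fin invr_gt0.
    by rewrite (gt0_muley vi) poweRyr ?gt_eqF ?invr_gt0// leey.
  have I'f : I' \is a fin_num by rewrite ge0_fin_numE.
  have S0 : 0 <= fine I' by rewrite fine_ge0.
  have IS := integral_powR_le mQ mg muQ v0 r0 rr' (esym (fineK I'f)).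
  apply: (@le_trans _ _ (((vol Q)^-1 * (vol Q `^ (1 - r / r') *
      fine I' `^ (r / r')))%:E `^ r^-1)%E).
    apply: le_poweR2l; [by rewrite invr_ge0 ltW|exact: vI0|].
    by rewrite EFinM; apply: lee_wpmul2l.
  rewrite -(fineK I'f) -EFinM !poweR_EFin lee_fin le_eqVlt; apply/orP; left.
  apply/eqP; rewrite mulrA.
  have -> : (vol Q)^-1 * vol Q `^ (1 - r / r') = (vol Q)^-1 `^ (r / r').
    rewrite powRB ?(gt_eqF v0) ?implybT// powRr1 ?(ltW v0)// mulrA mulVf ?gt_eqF// mul1r.
    by rewrite -[in RHS]powR_inv1 ?(ltW v0)// -powRrM mulN1r powRN.
  rewrite -powRM// -powRrM; congr (_ `^ _); field.
  by rewrite !gt_eqF.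
- apply: le_ereal_inf_tmp => y yQ; have y0 := ae_le_ge0 cQ yQ.
  case: y y0 yQ => [y|_ _|//]; last exact: leey.
  rewrite lee_fin => y0 yQ; rewrite /avg.
  have Iy := integral_powR_ae_le mQ mg muQ (ltW r0) y0 yQ.
  have -> : y%:E = (y%:E `^ r `^ r^-1)%E.
    by rewrite -poweRrM mulfV ?gt_eqF// poweRe1.
  apply: le_poweR2l; [by rewrite invr_ge0 ltW|exact: vI0|].
  rewrite poweR_EFin; have := @lee_wpmul2l R (vol Q)^-1%:E _ _ _ Iy.
  rewrite lee_fin => /(_ vi0) /le_trans; apply.
  by rewrite -EFinM lee_fin mulrCA mulVf ?gt_eqF// mulr1.
Qed.

Lemma avg1E Q g : cube Q -> mu.-integrable Q (EFin \o g) ->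
  avg 1%:E Q g = ((vol Q)^-1 * \int[mu]_(x in Q) `|g x|)%:E.
Proof.
move=> cQ gi; have [mQ muQ v0 _] := cubeP cQ.
have ngi : mu.-integrable Q (EFin \o (fun x => `|g x|)) by exact: integrable_norm.
rewrite /avg invr1 poweRe1; last first.
  rewrite mule_ge0 ?lee_fin ?invr_ge0 ?(ltW v0)//.
  by apply: integral_ge0 => x _; rewrite lee_fin powR_ge0.
rewrite EFinM; congr (_ * _)%E.
rewrite /Rintegral fineK; last exact: (integrable_fin_num mQ ngi).
by apply: eq_integral => x _; rewrite powRr1.
Qed.

(* For finite [q] this is convexity of [t `^ q], applied to the convex
   combination of [|g x|] and [avg q Q g] with weights [1 / (1 + k)] and
   [k / (1 + k)]. *)
Lemma avg_perturb q Q g h k : cube Q -> (1 <= q)%E ->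
  measurable_fun Q g -> measurable_fun Q h -> 0 <= k ->
  (forall x, Q x -> (`|h x|%:E <= `|g x|%:E + k%:E * avg 1 Q g)%E) ->
  (avg q Q h <= (1 + k)%:E * avg q Q g)%E.
Proof.
move=> cQ q1 mg mh k0 hg; have [mQ muQ v0 _] := cubeP cQ.
have vi0 : 0 <= (vol Q)^-1 by rewrite invr_ge0 ltW.
have k1 : 0 < 1 + k by rewrite ltr_pwDl.
have A0 := avg_ge0 q g cQ.
case: (ltP (avg q Q g) +oo%E) => [Ay|]; last first.
  by rewrite leye_eq => /eqP ->; rewrite gt0_muley ?lte_fin// leey.
have Af : avg q Q g \is a fin_num by rewrite ge0_fin_numE.
pose a := fine (avg q Q g).
have aE : avg q Q g = a%:E by rewrite fineK.
have a0 : 0 <= a by rewrite fine_ge0.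
(* The mean of [|g|] is replaced by the larger [q]-average [a]. *)
have {}hg x : Q x -> `|h x| <= `|g x| + k * a.
  move=> Qx; rewrite -lee_fin EFinD EFinM -aE; apply: (le_trans (hg x Qx)).
  by apply: leeD2l; apply: lee_wpmul2l => //; exact: avg_le.
case: q q1 A0 Ay Af @a aE a0 hg => [r| |//] r1 A0 Ay Af a aE a0 hg.
- have r0 : 0 < r by rewrite (lt_le_trans ltr01)// -lee_fin.
  set I := (\int[mu]_(x in Q) (`|g x| `^ r)%:E)%E.
  have I0 : (0 <= I)%E by exact: integral_powR_abs_ge0.
  have vI : ((vol Q)^-1%:E * I = (a `^ r)%:E)%E.
    rewrite -poweR_EFin -aE /avg -/I -poweRrM mulVf ?gt_eqF// poweRe1//.
    by rewrite mule_ge0.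
  have IE : (I = (vol Q * a `^ r)%:E)%E.
    by rewrite EFinM -vI muleA -EFinM divff ?gt_eqF// mul1e.
  have r1' : 1 <= r by rewrite -lee_fin.
  have hI := integral_powR_perturb mQ mg mh muQ r1' k0 a0 IE hg.
  rewrite aE.
  have -> : ((1 + k)%:E * a%:E = (((1 + k) * a)%:E `^ r) `^ r^-1)%E.
    by rewrite -poweRrM mulfV ?gt_eqF// poweRe1 ?EFinM// lee_fin mulr_ge0 ?(ltW k1).
  rewrite {1}/avg.
  apply: le_poweR2l; first by rewrite invr_ge0 ltW.
    by apply: mule_ge0; [rewrite lee_fin|exact: integral_powR_abs_ge0].
  rewrite poweR_EFin; have := @lee_wpmul2l R (vol Q)^-1%:E _ _ _ hI.
  rewrite lee_fin => /(_ vi0) /le_trans; apply.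
  rewrite -EFinM lee_fin powRM ?(ltW k1)//.
  have -> : (1 + k) `^ r = (1 + k) `^ (r - 1) * (1 + k).
    by rewrite -mulr_powRB1 ?(ltW k1)// mulrC.
  by rewrite le_eqVlt; apply/orP; left; apply/eqP; field; rewrite gt_eqF.
(* An almost everywhere bound of [|g|], shifted by [k * a], becomes one of [|h|]. *)
- have -> : ((1 + k)%:E * avg +oo Q g = avg +oo Q g + (k * a)%:E)%E.
    by rewrite aE -EFinM -EFinD mulrDl mul1r.
  rewrite -leeBlDr// {2}/avg; apply: le_ereal_inf_tmp => y yQ.
  rewrite leeBlDr//; apply: ereal_inf_lbound.
  apply: filterS yQ => x gy Qx; apply: (@le_trans _ _ (`|g x|%:E + (k * a)%:E)%E).
    by rewrite -EFinD lee_fin hg.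
  by apply: leeD2r; exact: gy.
Qed.

End averages.

(** * Local Lebesgue spaces *)

Section local_spaces.
Context {R : realType} {n : nat}.
Local Notation mu := (lebesgue R n).
Implicit Types (X E Q : set (Rn R n)) (f g : Rn R n -> R).

Lemma bounded_subset_cube E : boundedn E -> exists2 Q, cube Q & E `<=` Q.
Proof.
move=> [M EM].
(* The added [1] keeps the edge length positive when [M] is zero. *)
exists (box (fun=> - `|M|) (2 * `|M| + 1) (fun=> true) (fun=> true)).
  exists (fun=> - `|M|), (2 * `|M| + 1), (fun=> true), (fun=> true).
  by split=> //; have := normr_ge0 M; lra.
move=> x Ex i; have := EM x Ex i; have := ler_norm M; have := normr_ge0 M.
rewrite in_itv/= -/(coordn x i) => M0 MM; rewrite ler_norml => /andP[x1 x2].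
by apply/andP; split; lra.
Qed.

Lemma bounded_lty E : measurable E -> boundedn E -> (mu E < +oo)%E.
Proof.
move=> mE /bounded_subset_cube[Q cQ EQ]; have [mQ muQ _ _] := cubeP cQ.
apply: (@le_lt_trans _ _ (mu Q)); last by rewrite muQ ltry.
by apply: le_measure; rewrite ?inE.
Qed.

Lemma lebesgue_setT_gt0 : (0 < mu setT)%E.
Proof.
have [|Q cQ _] := @bounded_subset_cube set0; first by exists 0.
have [mQ muQ v0 _] := cubeP cQ.
apply: (@lt_le_trans _ _ (mu Q)); first by rewrite muQ lte_fin.
by apply: le_measure; rewrite ?inE.
Qed.

(** Bounded measurable sets have finite measure, so higher integrability on them implies lower. *)
Lemma Lloc_le (p q : \bar R) X f : (1 <= p)%E -> (p <= q)%E ->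
  measurable X -> Lloc q X f -> Lloc p X f.
Proof.
move=> p1 pq mX [mf fq]; split => // E mE bE EX.
have mfE : measurable_fun E f by exact: measurable_funS mf.
have := fq E mE bE EX; have muE := bounded_lty mE bE.
case: p p1 pq => [r|_|//]; last by rewrite leye_eq => /eqP ->.
rewrite lee_fin => r1; have r0 : 0 < r by exact: lt_le_trans r1.
case: q fq => [r' _|_ _|//]; last first.
- move=> /(Lnormy_indic_ae lebesgue_setT_gt0)[M M0 fM].
  apply/(Lnorm_indic_lty mu E f r0).
  have muEf : mu E = (fine (mu E))%:E by rewrite fineK// ge0_fin_numE.
  apply: le_lt_trans (integral_powR_ae_le mE mfE muEf (ltW r0) M0 fM) _.
  exact: ltry.
rewrite lee_fin => rr'; have r'0 : 0 < r' by exact: lt_le_trans rr'.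
move=> /(Lnorm_indic_lty mu E f r'0) fr'; apply/(Lnorm_indic_lty mu E f r0).
exact: integral_powR_lty fr'.
Qed.

Lemma Lloc_integrable q X Q f : (1 <= q)%E -> measurable X -> Lloc q X f ->
  cube Q -> Q `<=` X -> mu.-integrable Q (EFin \o f).
Proof.
move=> q1 mX fq cQ QX; have [mQ muQ v0 _] := cubeP cQ.
have [mf f1] := Lloc_le (lexx 1%E) q1 mX fq.
have mfQ : measurable_fun Q f by exact: measurable_funS mf.
apply/integrableP; split; first exact/measurable_EFinP.
have := f1 Q mQ (cube_bounded cQ) QX.
move=> /(Lnorm_indic_lty mu Q f ltr01).
by apply: le_lt_trans; rewrite le_eqVlt; apply/orP; left; apply/eqP;
  apply: eq_integral => x _; rewrite /= powRr1.
Qed.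

Lemma measurable_setT_or_cube X : X = setT \/ cube X -> measurable X.
Proof. by move=> [->//|/cubeP[]]. Qed.

End local_spaces.

(** * Comparison of oscillations and of norms *)

Section JohnNirenberg.
Context {R : realType} {n : nat}.
Local Notation mu := (lebesgue R n).
Implicit Types (X Q : set (Rn R n)) (f : Rn R n -> R).

Lemma osc_ge0 q s alpha f Q : cube Q -> (0 <= osc q s alpha f Q)%E.
Proof.
by move=> cQ; apply: mule_ge0; [rewrite lee_fin powR_ge0|exact: avg_ge0].
Qed.

Lemma vol_ge0 Q : 0 <= vol Q.
Proof. by rewrite /vol fine_ge0. Qed.

Lemma packing_term_ge0 r q s alpha f Q :
  (0 <= (vol Q)%:E * osc q s alpha f Q `^ r)%E.
Proof. by rewrite mule_ge0 ?poweR_ge0// lee_fin vol_ge0. Qed.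

(* Sub-cubes enter through open subsets of full measure of their interiors,
   which are pairwise disjoint. *)
Lemma packing_vol Q (C F : set (set (Rn R n))) : cube Q -> packing Q C ->
  finite_set F -> F `<=` C -> (\sum_(Q' \in F) (vol Q')%:E <= (vol Q)%:E)%E.
Proof.
move=> cQ [CQ Cdisj] finF FC; have [mQ muQ _ _] := cubeP cQ.
have /choice[U HU] : forall Q' : set (Rn R n), exists U : set (Rn R n), cube Q' ->
    [/\ measurable U, U `<=` interiorn Q', U `<=` Q' & mu U = mu Q'].
  move=> Q'.
  have [/cubeP[_ _ _ [U HU]]|ncQ] := pselect (cube Q'); first by exists U.
  by exists set0.
have FO Q' : F Q' -> [/\ measurable (U Q'), U Q' `<=` interiorn Q',
    U Q' `<=` Q & mu (U Q') = (vol Q')%:E].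
  move=> /FC/CQ[cQ' Q'Q]; have [mO Oi OQ muO] := HU _ cQ'.
  split => //; first exact: subset_trans Q'Q.
  by rewrite muO; have [] := cubeP cQ'.
rewrite (eq_fsbigr (fun Q' => mu (U Q'))); last first.
  by move=> Q'; rewrite inE => /FO[].
rewrite -measure_fin_bigcup//.
- rewrite -muQ; apply: le_measure; rewrite ?inE//.
    by apply: fin_bigcup_measurable => // Q' /FO[].
  by move=> x [Q' /FO[_ _ OQ _]]; exact: OQ.
- move=> Q1 Q2 FQ1 FQ2 [x [m1 m2]]; apply: contrapT => Q12.
  have [_ i1 _ _] := FO _ FQ1; have [_ i2 _ _] := FO _ FQ2.
  have : (interiorn Q1 `&` interiorn Q2) x by split; [exact: i1|exact: i2].
  by rewrite Cdisj//; exact: FC.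
- by move=> Q' /FO[].
Qed.

(** Reduces (ii), with [k = 1], and (iii) to a comparison on each cube: the r-th power of [k]
    factors out of every packing sum. *)
Lemma JNnorm_le p q q' s s' alpha X f (k : R) : (1 <= p)%E -> 0 < k ->
  (forall Q, cube Q -> Q `<=` X ->
    (osc q s alpha f Q <= k%:E * osc q' s' alpha f Q)%E) ->
  (JNnorm p q s alpha X f <= k%:E * JNnorm p q' s' alpha X f)%E.
Proof.
move=> p1 k0 oscle; case: p p1 => [r|_|//] /=; last first.
  apply: ge_ereal_sup => _ [Q [cQ QX] <-]; apply: (le_trans (oscle Q cQ QX)).
  apply: lee_wpmul2l; first by rewrite lee_fin ltW.
  by apply: ereal_sup_ubound; exists Q.
rewrite lee_fin => r1; have r0 : 0 < r by exact: lt_le_trans r1.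
set S' := ereal_sup [set \esum_(Q in C) ((vol Q)%:E * osc q' s' alpha f Q `^ r)
  | C in packing X]%E.
have S'0 : (0 <= S')%E.
  (* The empty packing contributes the value zero. *)
  apply: ereal_sup_ubound; exists set0; last by rewrite esum_set0.
  by split.
have kr0 : (0 <= (k `^ r)%:E)%E by rewrite lee_fin powR_ge0.
have -> : (k%:E * S' `^ r^-1 = ((k `^ r)%:E * S') `^ r^-1)%E.
  rewrite poweRM// -poweR_EFin -poweRrM mulfV ?gt_eqF// poweRe1//.
  by rewrite lee_fin ltW.
apply: le_poweR2l; first by rewrite invr_ge0 ltW.
  apply: ereal_sup_ubound; exists set0; last by rewrite esum_set0.
  by split.
apply: ge_ereal_sup => _ [C pC <-]; apply: ge_ereal_sup => _ [F [finF FC] <-].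
apply: (@le_trans _ _ (\sum_(Q \in F)
    ((k `^ r)%:E * ((vol Q)%:E * osc q' s' alpha f Q `^ r)))%E).
  apply: lee_fsum => // Q /FC/pC.1[cQ QX].
  rewrite muleCA; apply: lee_wpmul2l; first by rewrite lee_fin vol_ge0.
  rewrite -poweR_EFin -poweRM ?lee_fin ?(ltW k0)//; last exact: osc_ge0.
  apply: le_poweR2l; [exact: ltW|exact: osc_ge0|exact: oscle].
rewrite -ge0_mule_fsumr; last by move=> Q; exact: packing_term_ge0.
apply: lee_wpmul2l => //.
apply: (@le_trans _ _
  (\esum_(Q in C) ((vol Q)%:E * osc q' s' alpha f Q `^ r))%E).
  by apply: ereal_sup_ubound; exists F.
by apply: ereal_sup_ubound; exists C.
Qed.

Lemma fin_mul_lty (c : R) (y : \bar R) : 0 <= c -> (y < +oo)%E ->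
  (c%:E * y < +oo)%E.
Proof.
rewrite le_eqVlt => /predU1P[<-|c0]; first by rewrite mul0e ltry.
case: y => [y _||_] //; first by rewrite -EFinM ltry.
by rewrite gt0_muleNy ?lte_fin.
Qed.

Lemma osc_le_q p q s alpha X f Q : (1 <= p)%E -> (p <= q)%E ->
  measurable_fun Q f -> cube Q ->
  (osc p s alpha f Q <= osc q s alpha f Q)%E.
Proof.
move=> p1 pq mf cQ; have [mQ _ _ _] := cubeP cQ.
apply: lee_wpmul2l; first by rewrite lee_fin powR_ge0.
apply: (avg_le cQ _ p1 pq); apply: measurable_funB; first exact: mf.
by apply/measurable_EFinP; exact: (measurable_int mu (integrable_peval _ cQ)).
Qed.

(** An instance of [avg_perturb] with [k = 2 * C], whose functions are the residuals of degrees [s]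
    and [s + 1]; the triangle inequality compares them. *)
Lemma osc_le_s q s alpha f Q C : (1 <= q)%E -> cube Q ->
  mu.-integrable Q (EFin \o f) -> polyproj_bound n s.+1 C ->
  (osc q s.+1 alpha f Q <= (1 + 2 * C)%:E * osc q s alpha f Q)%E.
Proof.
move=> q1 cQ fi CP; have C0 : 0 <= C by rewrite (le_trans _ CP.1).
rewrite /osc muleCA; apply: lee_wpmul2l; first by rewrite lee_fin powR_ge0.
have nfi : mu.-integrable Q (EFin \o (fun y => `|f y|)).
  by have [mQ _ _ _] := cubeP cQ; exact: integrable_norm.
have gi t := integrable_sub_peval (polyproj t Q (fun y => `|f y|)) cQ fi.
have mg t : measurable_fun Q (fun x => f x - peval (polyproj t Q (fun y => `|f y|)) x).
  by apply/measurable_EFinP; exact: (measurable_int mu (gi t)).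
apply: avg_perturb => //; first by rewrite mulr_ge0.
move=> x Qx; rewrite avg1E// -EFinM -EFinD lee_fin.
have := polyproj_succ_diff CP cQ fi Qx (polyproj_exists s cQ nfi)
  (polyproj_exists s.+1 cQ nfi).
move=> /(lerD (lexx _))/(le_trans _); apply.
by rewrite [X in _ <= _ + X]distrC ler_distD.
Qed.

(** For finite [p'], the tangent line is summed over a packing with the volumes as weights. For
    [p' = +oo], every oscillation is at most the norm. *)
Lemma JNnorm_le_p (p p' q : \bar R) s alpha (Q0 : set (Rn R n)) f :
  cube Q0 -> (1 <= p)%E -> (p <= p')%E ->
  ((vol Q0 `^ (- fine (p^-1)%E))%:E * JNnorm p q s alpha Q0 f
    <= (vol Q0 `^ (- fine (p'^-1)%E))%:E * JNnorm p' q s alpha Q0 f)%E.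
Proof.
move=> cQ0; have [mQ0 muQ0 v0 _] := cubeP cQ0.
case: p => [r|_|//]; last by rewrite leye_eq => /eqP ->.
rewrite lee_fin => r1; have r0 : 0 < r by exact: lt_le_trans r1.
have rV (t : R) : 0 < t -> fine (t%:E^-1)%E = t^-1.
  by move=> t0; rewrite inver gt_eqF.
have vr : (vol Q0 `^ (- r^-1))%:E = ((vol Q0)^-1%:E `^ r^-1)%E.
  by rewrite poweR_EFin -[(vol Q0)^-1]powR_inv1 ?(ltW v0)// -powRrM mulN1r.
set a := fun t Q => ((vol Q)%:E * osc q s alpha f Q `^ t)%E.
have a0 t Q : (0 <= a t Q)%E by exact: packing_term_ge0.
(* Since [\esum] is a supremum of finite sums, a bound [b] of these bounds the normalized norm. *)
have reduce (b : R) : (forall C F, packing Q0 C -> finite_set F -> F `<=` C ->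
    \sum_(Q \in F) a r Q <= b%:E)%E ->
    ((vol Q0 `^ (- fine (r%:E^-1)%E))%:E * JNnorm r%:E q s alpha Q0 f
      <= (((vol Q0)^-1 * b) `^ r^-1)%:E)%E.
  move=> Hb; rewrite rV// vr {1}/JNnorm -poweRM ?lee_fin ?invr_ge0 ?(ltW v0)//; last first.
    apply: ereal_sup_ubound; exists set0; last by rewrite esum_set0.
    by split.
  rewrite -poweR_EFin; apply: le_poweR2l; rewrite ?invr_ge0 ?(ltW r0)//.
    apply: mule_ge0; first by rewrite lee_fin invr_ge0 ltW.
    apply: ereal_sup_ubound; exists set0; last by rewrite esum_set0.
    by split.
  rewrite EFinM; apply: lee_wpmul2l; first by rewrite lee_fin invr_ge0 ltW.
  apply: ge_ereal_sup => _ [C pC <-]; apply: ge_ereal_sup => _ [F [finF FC] <-].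
  exact: Hb pC finF FC.
case: p' => [r'|_|//].
- rewrite lee_fin => rr'; have r'0 : 0 < r' by exact: lt_le_trans rr'.
  have th : 0 < r / r' <= 1 by rewrite divr_gt0//= ler_pdivrMr ?mul1r.
  have /andP[th0 th1] := th.
  rewrite [in leRHS]rV// [in leRHS]/JNnorm -/(a r').
  set S' := ereal_sup _.
  have S'0 : (0 <= S')%E.
    apply: ereal_sup_ubound; exists set0; last by rewrite esum_set0.
    by split.
  have [S'y|] := ltP S' +oo%E; last first.
    rewrite leye_eq => /eqP ->; rewrite poweRyr ?gt_eqF ?invr_gt0//.
    have c0 : (0 < (vol Q0 `^ (- r'^-1))%:E)%E by rewrite lte_fin powR_gt0.
    by rewrite (gt0_muley c0) leey.
  have S'f : S' \is a fin_num by rewrite ge0_fin_numE.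
  have S0 : 0 <= fine S' by rewrite fine_ge0.
  apply: (le_trans (reduce (vol Q0 `^ (1 - r / r') * fine S' `^ (r / r')) _)).
    move=> C F pC finF FC.
    apply: power_mean_bound => // lam lam0.
    have la0 : 0 <= lam `^ (r / r') by exact: powR_ge0.
    have A0 : 0 <= lam `^ (r / r') * (1 - r / r') by rewrite mulr_ge0// subr_ge0.
    have B0 : 0 <= lam `^ (r / r') * (r / r') / lam.
      by rewrite divr_ge0 ?(ltW lam0)// mulr_ge0// ltW.
    apply: (@le_trans _ _ (\sum_(Q \in F)
      ((lam `^ (r / r') * (1 - r / r'))%:E * (vol Q)%:E +
       (lam `^ (r / r') * (r / r') / lam)%:E * a r' Q))%E).
      apply: lee_fsum => // Q /FC/pC.1[cQ _];
        rewrite /a [X in (_ <= X + _)%E]muleC [X in (_ <= _ + X)%E]muleCA -muleDr//.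
      apply: lee_wpmul2l; first by rewrite lee_fin vol_ge0.
      by apply: poweR_tangent => //; exact: osc_ge0.
    rewrite fsbig_split//= -!ge0_mule_fsumr//; last first.
      by move=> Q; rewrite lee_fin vol_ge0.
    rewrite EFinD !EFinM; apply: leeD.
      by apply: lee_wpmul2l; [rewrite -EFinM lee_fin|exact: packing_vol pC finF FC].
    apply: lee_wpmul2l; first by rewrite -!EFinM lee_fin.
    rewrite fineK//; apply: (@le_trans _ _ (\esum_(Q in C) a r' Q)%E).
      by apply: ereal_sup_ubound; exists F.
    by apply: ereal_sup_ubound; exists C.
  rewrite -(fineK S'f) poweR_EFin -EFinM lee_fin le_eqVlt; apply/orP; left.
  apply/eqP; rewrite mulrA.
  have -> : (vol Q0)^-1 * vol Q0 `^ (1 - r / r') = vol Q0 `^ (- (r / r')).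
    rewrite powRB ?(gt_eqF v0) ?implybT// powRr1 ?(ltW v0)// mulrA mulVf ?gt_eqF// mul1r.
    by rewrite powRN.
  rewrite powRM ?powR_ge0// -!powRrM; congr (_ `^ _ * _ `^ _); field;
    by rewrite !gt_eqF.
(* With [1 / +oo = 0], the volume factor on the right is [1]. *)
rewrite invey [fine 0%E]/= oppr0 powRr0 mul1e [leRHS]/JNnorm.
set N := leRHS.
have NQ Q : cube Q -> Q `<=` Q0 -> (osc q s alpha f Q <= N)%E.
  by move=> cQ QQ0; apply: ereal_sup_ubound; exists Q.
have N0 : (0 <= N)%E by apply: le_trans (NQ Q0 cQ0 _) => //; exact: osc_ge0.
have [Ny|] := ltP N +oo%E; last by rewrite leye_eq => /eqP ->; rewrite leey.
have Nf : N \is a fin_num by rewrite ge0_fin_numE.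
have N0' : 0 <= fine N by rewrite fine_ge0.
apply: (le_trans (reduce (fine N `^ r * vol Q0) _)).
  move=> C F pC finF FC.
  apply: (@le_trans _ _ (\sum_(Q \in F) ((fine N `^ r)%:E * (vol Q)%:E))%E).
    apply: lee_fsum => // Q /FC/pC.1[cQ QQ0]; rewrite /a muleC.
    apply: lee_wpmul2r; first by rewrite lee_fin vol_ge0.
    rewrite -poweR_EFin fineK//.
    by apply: le_poweR2l; [exact: ltW|exact: osc_ge0|exact: NQ].
  rewrite -ge0_mule_fsumr; last by move=> Q; rewrite lee_fin vol_ge0.
  rewrite EFinM; apply: lee_wpmul2l; first by rewrite lee_fin powR_ge0.
  exact: packing_vol pC finF FC.
rewrite mulrCA mulVf ?gt_eqF// mulr1 -powRrM mulfV ?gt_eqF// powRr1//.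
by rewrite fineK.
Qed.

End JohnNirenberg.

(* [fine (p^-1)%E] is 1/p, with 1/oo = 0. *)
Theorem proposition3p1 (R : realType) (n : nat) (hn : (0 < n)%N)
    (p q : \bar R) (hp : (1 <= p)%E) (hq : (1 <= q)%E) (s : nat) (alpha : R)
    (Q0 : set (Rn R n)) (hQ0 : cube Q0)
    (X : set (Rn R n)) (hX : X = setT \/ cube X) :
  [/\
    (forall p' : \bar R, (p <= p')%E ->
      JN p' q s alpha Q0 `<=` JN p q s alpha Q0 /\
      forall f : Rn R n -> R, Lloc q Q0 f ->
        ((vol Q0 `^ (- fine (p^-1)%E))%:E * JNnorm p q s alpha Q0 f
          <= (vol Q0 `^ (- fine (p'^-1)%E))%:E * JNnorm p' q s alpha Q0 f)%E),
    (forall q' : \bar R, (q <= q')%E ->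
      JN p q' s alpha X `<=` JN p q s alpha X /\
      forall f : Rn R n -> R, Lloc q' X f ->
        (JNnorm p q s alpha X f <= JNnorm p q' s alpha X f)%E)
  & JN p q s alpha X `<=` JN p q s.+1 alpha X /\
    forall Cs Cs1 : R, polyproj_bound n s Cs -> polyproj_bound n s.+1 Cs1 ->
    forall f : Rn R n -> R, Lloc q X f ->
      (JNnorm p q s.+1 alpha X f
        <= ((1 + Cs1) * (1 + Cs) + Cs * Cs1)%:E * JNnorm p q s alpha X f)%E ].
Proof.
have mX := measurable_setT_or_cube hX.
split.
- move=> p' pp'.
  have le f := @JNnorm_le_p R n p p' q s alpha Q0 f hQ0 hp pp'.
  split=> [f [fq fy]|f _]; last exact: le.
  split => //; have [_ _ v0 _] := cubeP hQ0.
  have := le_lt_trans (le f) (fin_mul_lty (powR_ge0 _ _) fy).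
  (* An infinite norm would stay infinite after multiplication by the positive volume factor. *)
  rewrite !ltey; apply: contraNN => /eqP ->.
  by rewrite gt0_muley// lte_fin powR_gt0.
- move=> q' qq'.
  have le f : Lloc q' X f -> (JNnorm p q s alpha X f <= JNnorm p q' s alpha X f)%E.
    move=> [mf _]; rewrite -[leRHS]mul1e; apply: JNnorm_le => // Q cQ QX.
    rewrite mul1e; apply: osc_le_q => //.
    by have [mQ _ _ _] := cubeP cQ; exact: measurable_funS mf.
  split => // f [fq' fy]; split; first exact: Lloc_le fq'.
  exact: le_lt_trans (le f fq') fy.
- have le C f : polyproj_bound n s.+1 C -> Lloc q X f ->
      (JNnorm p q s.+1 alpha X f <= (1 + 2 * C)%:E * JNnorm p q s alpha X f)%E.
    move=> CP fq; have C1 := CP.1; apply: JNnorm_le => //; first lra.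
    move=> Q cQ QX; apply: osc_le_s => //; exact: Lloc_integrable fq cQ QX.
  split=> [f [fq fy]|Cs Cs1 Hs Hs1 f fq].
    split; first exact: fq.
    (* The inclusion is stated without a constant, so one is supplied. *)
    have [C CP] := @polyproj_bound_exists R n s.+1.
    apply: le_lt_trans (le C f CP fq) (fin_mul_lty _ fy).
    by have := CP.1; lra.
  have C0 := Hs.1; have C1 := Hs1.1.
  apply: JNnorm_le => //; first nra.
  move=> Q cQ QX; apply: (le_trans (osc_le_s alpha hq cQ _ Hs1)).
    exact: Lloc_integrable fq cQ QX.
  apply: lee_wpmul2r; first exact: osc_ge0.
  (* The claimed constant expands to [1 + Cs + Cs1 + 2 * Cs * Cs1], and [Cs >= 1]. *)
  by rewrite lee_fin; nra.
Qed.
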